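(* Let $X=\mathbb{N}^{\mathbb{N}}$ with the shift $T$. Let $\mu\in\mathcal{M}(X,T)$ be a $T$-invariant Borel probability measure on $X$ and let $\varphi:X\to\mathbb{R}$ be a potential function of summable variations admitting a unique Gibbs measure $\nu$, with convergence exponent $\alpha_\nu$. Then $$\dim_\nu G_\mu=\max\left\{\alpha_\nu,\ \beta(\nu|\mu)\right\}.$$
   Context: $X=\mathbb{N}^{\mathbb{N}}$ ($\mathbb{N}=\{1,2,\dots\}$) carries the product topology and $T(x_1x_2x_3\cdots)=(x_2x_3\cdots)$. $\mathcal{M}(X,T)$ is the set of $T$-invariant Borel probability measures on $X$. For a finite word $\omega=\omega_1\cdots\omega_n$, the cylinder $[\omega]$ is the set of $x\in X$ having $\omega$ as prefix (the cylinder of the empty word is $X$). Write $S_nf(x)=\sum_{i=0}^{n-1}f(T^ix)$. Generic points: $G_\mu=\{x\in X:\lim_{n\to\infty}\frac1n S_nf(x)=\int_X f\,d\mu\ \text{for all } f\in C_b(X)\}$, where $C_b(X)$ is the space of bounded real-valued continuous functions on $X$. Potentials: for $\varphi:X\to\mathbb{R}$, $\mathrm{var}_n\varphi=\sup\{|\varphi(x)-\varphi(y)|:x_i=y_i,\ 1\le i\le n\}$; $\varphi$ has summable variations if $\sum_{n=2}^\infty\mathrm{var}_n\varphi<\infty$. A Gibbs measure associated to $\varphi$ is a $T$-invariant Borel probability measure $\nu$ for which there are constants $C>1$ and $P\in\mathbb{R}$ with $C^{-1}\le \nu([x_1\cdots x_n])/\exp(S_n\varphi(x)-nP)\le C$ for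 all $n\ge1$, $x\in X$. (It is known that a $\varphi$ with summable variations admits a unique Gibbs measure iff $\mathrm{var}_1\varphi<\infty$ and its Gurevich pressure is finite; then $P$ is the Gurevich pressure.) Dimension: $\nu$ induces the metric $\rho_\nu$ on $X$ given by $\rho_\nu(x,x)=0$ and, for $x\ne y$, $\rho_\nu(x,y)=\nu([x_1\cdots x_n])$ with $n=\min\{k\ge0:x_{k+1}\ne y_{k+1}\}$. $\dim_\nu$ denotes Hausdorff dimension with respect to $\rho_\nu$ (Billingsley dimension). Exponents: $\alpha_\nu=\inf\{t>0:\sum_{n=1}^\infty\nu([n])^t<+\infty\}$, and $$\beta(\nu|\mu)=\limsup_{k\to\infty}\limsup_{N\to\infty}\frac{\sum_{\omega\in\Sigma_N^k}\mu([\omega])\ln\mu([\omega])}{\sum_{\omega\in\Sigma_N^k}\mu([\omega])\ln\nu([\omega])},\qquad \Sigma_N^k=\{1,\dots,N\}^k,$$ with $0\ln0=0$. *)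

(* Defs.v *)
From HB Require Import structures.
From mathcomp Require Import all_boot all_order all_algebra.
From mathcomp Require Import all_classical all_reals all_analysis.

Set Implicit Arguments.
Unset Strict Implicit.
Unset Printing Implicit Defensive.

Import Order.TTheory GRing.Theory Num.Theory.
Import numFieldNormedType.Exports.

Local Open Scope classical_set_scope.
Local Open Scope ring_scope.

(* Letters and indices start from 0 instead of 1: the sequence x_1 x_2 ... of
   positive integers is encoded by [fun i => x_(i+1) - 1]. In particular the
   alphabet {1, ..., N} becomes ['I_N]. *)

Definition shift_space : Type := prod_topology (fun _ : nat => nat).
HB.instance Definition _ := Pointed.on shift_space.
HB.instance Definition _ := Nbhs.on shift_space.
HB.instance Definition _ := Topological.on shift_space.

Notation borel_shift_space := (g_sigma_algebraType (@open shift_space)).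

Definition shift (x : shift_space) : shift_space := fun i => x i.+1.

Definition word (x : shift_space) (n : nat) : seq nat := mkseq x n.

Definition cylinder (w : seq nat) : set shift_space :=
  [set x | word x (size w) = w].

Definition birkhoff_sum (R : realType) (f : shift_space -> R) (n : nat)
    (x : shift_space) : R :=
  \sum_(0 <= i < n) f (iter i shift x).

Section Measures.
Variable R : realType.
Implicit Types (mu nu : probability borel_shift_space R)
  (phi : shift_space -> R).

Definition shift_invariant mu : Prop :=
  forall A : set borel_shift_space, measurable A ->
    mu (shift @^-1` A) = mu A.

Definition generic_points mu : set shift_space :=
  [set x | forall f : shift_space -> R, continuous f -> bounded_fun f ->
     (fun n => n%:R^-1 * birkhoff_sum f n x) @ \oo --> \int[mu]_y f y].

Definition variation phi (n : nat) : \bar R :=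
  ereal_sup [set e | exists x y : shift_space,
    word x n = word y n /\ e = `|phi x - phi y|%:E].

Definition summable_variations phi : Prop :=
  (\sum_(2 <= n <oo) variation phi n < +oo)%E.

(* [mu [w]] as a real number; all the measures here are finite. *)
Definition cyl_mass mu (w : seq nat) : R := fine (mu (cylinder w)).

Definition gibbs phi nu : Prop :=
  shift_invariant nu /\
  exists C P : R, 1 < C /\
    forall (n : nat) (x : shift_space), (0 < n)%N ->
      C^-1 <= cyl_mass nu (word x n)
                / expR (birkhoff_sum phi n x - n%:R * P) <= C.

(* Measures are functions on all sets whose values are only meaningful on
   measurable ones, so uniqueness is equality on the Borel sets. *)
Definition unique_gibbs phi nu : Prop :=
  gibbs phi nu /\
  forall nu' : probability borel_shift_space R, gibbs phi nu' ->
    forall A : set borel_shift_space, measurable A -> nu' A = nu A.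

Definition cyl_dist nu (x y : shift_space) : R :=
  match pselect (exists k, x k != y k) with
  | left xy => cyl_mass nu (word x (ex_minn xy))
  | right _ => 0
  end.

Section Hausdorff.
Variables (T : Type) (d : T -> T -> R).

(* The supremum of the empty family is [-oo], whence the maximum with 0. *)
Definition diam (U : set T) : \bar R :=
  maxe 0%E (ereal_sup [set e | exists x y : T,
    [/\ U x, U y & e = (d x y)%:E]]).

Definition hausdorff_premeasure (s delta : R) (A : set T) : \bar R :=
  ereal_inf [set (\sum_(0 <= i <oo) poweR (diam (U i)) s)%E
    | U in [set U : nat -> set T |
        A `<=` \bigcup_i U i /\ forall i, (diam (U i) <= delta%:E)%E]].

Definition hausdorff_measure (s : R) (A : set T) : \bar R :=
  ereal_sup [set hausdorff_premeasure s delta A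
    | delta in [set delta : R | 0 < delta]].

(* Allowing s = 0 would not change the infimum; s > 0 avoids the convention
   on 0 to the power 0. The value is [+oo] if no s qualifies. *)
Definition hausdorff_dim (A : set T) : \bar R :=
  ereal_inf [set s%:E
    | s in [set s : R | 0 < s /\ hausdorff_measure s A = 0%E]].

End Hausdorff.

Definition billingsley_dim nu (A : set shift_space) : \bar R :=
  hausdorff_dim (cyl_dist nu) A.

Definition conv_exponent nu : \bar R :=
  ereal_inf [set t%:E | t in [set t : R | 0 < t /\
    (\sum_(0 <= n <oo) (cyl_mass nu [:: n] `^ t)%:E < +oo)%E]].

(* [ln 0 = 0] and [x / 0 = 0] here. For a Gibbs measure [nu], cylinders of
   words of length k > 0 have [nu]-mass in ]0, 1[, so for k > 0 and N large
   the denominator is negative and neither convention matters. *)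
Definition entropy_ratio nu mu (k N : nat) : R :=
  (\sum_(w : k.-tuple 'I_N)
     cyl_mass mu (map val w) * ln (cyl_mass mu (map val w)))
  / (\sum_(w : k.-tuple 'I_N)
     cyl_mass mu (map val w) * ln (cyl_mass nu (map val w))).

Definition relative_exponent nu mu : \bar R :=
  limn_esup (fun k => limn_esup (fun N => (entropy_ratio nu mu k N)%:E)).

End Measures.

(* Main.v *)
(* Write p and q for the masses of cylinders under mu and nu. The Gibbs property makes q
   quasi-multiplicative under concatenation, q(uv) ~ q(u) q(v), and nothing else about the
   potential matters.

   Upper bound. If s exceeds both exponents, then for suitable k and N the potential
   f(x) = ln g(w) - s ln q(w) - const, with w the first k letters of x, g(w) close to p(w) / 3
   on {1..N}^k and q(w)^s / 3 elsewhere, is bounded, continuous and of positive mu-mean. Along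
   a generic point its Birkhoff sums grow linearly, hence also along one residue class mod k,
   and this bounds q^s of a prefix by an exponentially small multiple of a product of
   sub-probability weights g. Such prefixes form covers with arbitrarily small s-sums.

   Lower bound. Concatenate blocks drawn from finite sets of words of a common length, all of
   whose members have nearly the frequencies of mu, with a probability weight at most
   q(block)^s / (2 K^s); the block sets vary so slowly that every concatenation is generic.
   The product weights make a mass distribution argument work. If s < alpha, the blocks are
   one typical word followed by a free letter, weighted by q(letter)^s; if s < beta, they
   are the typical words of the Bernoulli measure with the k-block law of mu. *)
Require Import Defs.
From mathcomp Require Import all_boot all_order all_algebra.
From mathcomp Require Import all_classical all_reals all_analysis.
From mathcomp Require Import ring lra zify.

Set Implicit Arguments.
Unset Strict Implicit.
Unset Printing Implicit Defensive.

Import Order.TTheory GRing.Theory Num.Theory.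
Import numFieldNormedType.Exports.

Local Open Scope classical_set_scope.
Local Open Scope ring_scope.

(* [shift] would otherwise denote a translation of MathComp-Analysis. *)
Local Notation shift := Defs.shift.

(** * Words and cylinders *)

(** A list instead of the tuple type of [entropy_ratio], so that sums split along concatenation;
    [sum_tuple_words] translates between the two. *)
Fixpoint words (N n : nat) : seq (seq nat) :=
  if n is n'.+1 then [seq a :: w | a <- iota 0 N, w <- words N n']
  else [:: [::]].

Lemma mem_words N n w :
  (w \in words N n) = (size w == n) && all (fun a => a < N)%N w.
Proof.
elim: n w => [|n IH] [|a w] //=.
- by apply/allpairsP => -[[b v]] /= [].
- rewrite eqSS; apply/allpairsP/and3P => [[[b v]] /= []|[sw aN wN]].
    by rewrite mem_iota IH => /= bN /andP[sv vN] [-> ->].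
  by exists (a, w) => /=; rewrite mem_iota IH aN sw wN.
Qed.

Lemma words_uniq N n : uniq (words N n).
Proof.
elim: n => //= n IH; apply: allpairs_uniq => //; first exact: iota_uniq.
by move=> [a u] [b v] _ _ /= [-> ->].
Qed.

Lemma size_mem_words N n w : w \in words N n -> size w = n.
Proof. by rewrite mem_words => /andP[/eqP]. Qed.

Lemma words_subset N N' n w : (N <= N')%N -> w \in words N n -> w \in words N' n.
Proof.
move=> NN'; rewrite !mem_words => /andP[-> /=]; apply: sub_all => a /leq_trans.
exact.
Qed.

Lemma words_wide w N : (\max_(a <- w) a.+1 <= N)%N -> w \in words N (size w).
Proof.
move=> wN; rewrite mem_words eqxx; apply/allP => a aw.
by apply: leq_trans wN; apply: (@leq_bigmax_seq _ _ _ S).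
Qed.

Lemma sum_words_add (R : nmodType) N a b (F : seq nat -> R) :
  \sum_(w <- words N (a + b)) F w =
  \sum_(u <- words N a) \sum_(v <- words N b) F (u ++ v).
Proof.
elim: a F => [|a IH] F; first by rewrite big_seq1.
rewrite addSn /= !big_allpairs_dep; apply: eq_bigr => i _.
exact: (IH (fun w => F (i :: w))).
Qed.

Lemma sum_words1 (R : nmodType) N (F : seq nat -> R) :
  \sum_(w <- words N 1) F w = \sum_(a < N) F [:: (a : nat)].
Proof.
have -> : words N 1 = [seq [:: a] | a <- iota 0 N].
  by rewrite /=; elim: (iota 0 N) => //= a s ->.
by rewrite big_map -[RHS](big_mkord xpredT (fun a => F [:: a])) /index_iota subn0.
Qed.

Lemma sum_tuple_words (R : nmodType) N k (F : seq nat -> R) :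
  \sum_(w : k.-tuple 'I_N) F (map val w) = \sum_(w <- words N k) F w.
Proof.
transitivity (\sum_(w <- [seq map val (tval w) | w : k.-tuple 'I_N]) F w).
  by rewrite big_map big_enum.
apply: perm_big; apply: uniq_perm; rewrite ?words_uniq//.
  rewrite map_inj_uniq ?enum_uniq// => u v /inj_map uv.
  by apply/val_inj/uv/val_inj.
move=> w; rewrite mem_words; apply/mapP/andP => [[u _ ->]|[/eqP sw /allP wN]].
  by rewrite size_map size_tuple eqxx; split => //; apply/allP => _ /mapP[a _ ->]; exact: ltn_ord.
have szf : size (pmap (insub : nat -> option 'I_N) w) == k.
  by rewrite size_pmap_sub -sw -all_count; apply/allP => a /wN.
exists (Tuple szf); first by rewrite mem_enum.
rewrite /=; move: wN {sw szf}; elim: w => //= a w IH wN.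
by rewrite insubT ?wN ?mem_head// => aN /=; rewrite -IH// => b bw; rewrite wN// inE bw orbT.
Qed.

Lemma leq_sum_subset (R : realDomainType) (I : eqType) (r1 r2 : seq I) (F : I -> R) :
  uniq r1 -> {subset r1 <= r2} -> (forall i, i \in r2 -> 0 <= F i) ->
  \sum_(i <- r1) F i <= \sum_(i <- r2) F i.
Proof.
move=> u1; elim: r1 u1 r2 => [_|x r1 IH /= /andP[xr1 u1]] r2 sub F0.
  by rewrite big_nil big_seq sumr_ge0.
have xr2 : x \in r2 by apply: sub; rewrite mem_head.
rewrite big_cons (perm_big _ (perm_to_rem xr2)) big_cons lerD2l.
apply: IH => // [y yr1|i ir].
  have := sub y; rewrite inE yr1 orbT => /(_ isT).
  rewrite (perm_mem (perm_to_rem xr2)) inE => /orP[/eqP yx|//].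
  by rewrite yx (negbTE xr1) in yr1.
by apply: F0; rewrite (mem_rem ir).
Qed.

Lemma size_word x n : size (word x n) = n.
Proof. exact: size_mkseq. Qed.

Lemma nth_word x n i : (i < n)%N -> nth 0%N (word x n) i = x i.
Proof. exact: nth_mkseq. Qed.

Lemma iter_shiftE i x j : iter i shift x j = x (i + j)%N.
Proof. by elim: i j => //= i IH j; rewrite /shift IH addnS. Qed.

Lemma word_add x m n : word x (m + n) = word x m ++ word (iter m shift x) n.
Proof.
apply: (@eq_from_nth _ 0%N) => [|i]; rewrite ?size_cat !size_word// => imn.
rewrite nth_cat size_word nth_word//; case: ltnP => im; first by rewrite nth_word.
by rewrite nth_word ?iter_shiftE ?subnKC// ltn_subLR.
Qed.

Lemma eq_word x y n : (forall i, (i < n)%N -> x i = y i) <-> word x n = word y n.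
Proof.
split=> [xy|xy i i_n]; last by rewrite -(nth_word x i_n) xy nth_word.
apply: (@eq_from_nth _ 0%N) => [|i]; rewrite !size_word// => i_n.
by rewrite !nth_word// xy.
Qed.

Lemma take_word x m n : (m <= n)%N -> take m (word x n) = word x m.
Proof. by move=> mn; rewrite -(subnKC mn) word_add take_size_cat ?size_word. Qed.

(** A canonical point of [cylinder w], at which functions of points are evaluated on words. *)
Definition pad (w : seq nat) : shift_space := fun i => nth 0%N w i.

Lemma word_pad w : word (pad w) (size w) = w.
Proof. exact: mkseq_nth. Qed.

Lemma word_pad_word x n : word (pad (word x n)) n = word x n.
Proof. by have := word_pad (word x n); rewrite size_word. Qed.

Lemma cylinder_cat u v x :
  cylinder (u ++ v) x <-> cylinder u x /\ cylinder v (iter (size u) shift x).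
Proof.
rewrite /cylinder/= size_cat word_add; split=> [/eqP|[-> ->]//].
by rewrite eqseq_cat ?size_word// => /andP[/eqP ? /eqP ?].
Qed.

(** The coordinates are discrete, so any condition on a finite prefix is open, whatever the
    predicate. *)
Lemma open_word_set n (P : seq nat -> Prop) : open [set x : shift_space | P (word x n)].
Proof.
rewrite openE => x /= Px; rewrite /interior/=.
have : nbhs x [set y : shift_space | forall i, (i < n)%N -> y i = x i].
  elim: n {P Px} => [|n IH]; first by
    apply: (@filterS _ (nbhs x) _ setT); [move=> ? _ ?; rewrite ltn0|exact: filterT].
  have xn := @proj_continuous nat (fun _ => nat) n x [set x n] (discrete_set1 _).
  apply: filterS (filterI IH xn) => y /= [yx yn] i.
  by rewrite ltnS leq_eqVlt => /predU1P[->|/yx].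
apply: filterS => y xy; suff yx : word y n = word x n by rewrite /= yx.
by apply/eq_word => i i_n; rewrite xy.
Qed.

Lemma measurable_word_set n (P : seq nat -> Prop) :
  measurable ([set x | P (word x n)] : set borel_shift_space).
Proof. by apply: sub_sigma_algebra; exact: open_word_set. Qed.

Lemma measurable_cylinder w : measurable (cylinder w : set borel_shift_space).
Proof. exact: (@measurable_word_set (size w) (fun u => u = w)). Qed.

(** The supersets of cylinders around [x] form a filter. It converges to [x] because it does so in
    each coordinate, and the product topology is the supremum of the coordinate topologies. *)
Lemma nbhs_word (x : shift_space) (A : set shift_space) : nbhs x A ->
  exists n, forall y, word y n = word x n -> A y.
Proof.
pose F : set_system shift_space :=
  [set B | exists n, forall y, word y n = word x n -> B y].
have FF : Filter F.
  split=> [|B C [m Bm] [n Cn]|B C BC [n Bn]].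
  - by exists 0%N.
  - exists (maxn m n) => y yx; split; [apply: Bm|apply: Cn].
      by rewrite -(take_word y (leq_maxl m n)) yx take_word// leq_maxl.
    by rewrite -(take_word y (leq_maxr m n)) yx take_word// leq_maxr.
  - by exists n => y /Bn /BC.
suff Fx : F --> x by exact: Fx.
apply/cvg_sup => i B; rewrite nbhsE => -[_ [[C _ <-] /= Cx] CB].
by exists i.+1 => y /eq_word yx; apply: CB; rewrite /= yx.
Qed.

(** * Masses of cylinders and integrals of locally constant functions *)

Section Mass.
Variables (R : realType) (mu : probability borel_shift_space R).
Local Notation p := (cyl_mass mu).

Lemma mu_fin (A : set borel_shift_space) : measurable A -> mu A \is a fin_num.
Proof. by move=> mA; exact: fin_num_measure. Qed.

Lemma fine_mu_le (A B : set borel_shift_space) : measurable A -> measurable B ->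
  A `<=` B -> fine (mu A) <= fine (mu B).
Proof.
move=> mA mB AB; apply: fine_le; rewrite ?mu_fin//.
by apply: le_measure; rewrite ?inE.
Qed.

Lemma cyl_massE w : mu (cylinder w) = (p w)%:E.
Proof. by rewrite /cyl_mass fineK// mu_fin//; exact: measurable_cylinder. Qed.

Lemma cyl_mass_ge0 w : 0 <= p w.
Proof. exact: fine_ge0. Qed.

Lemma cyl_mass_le1 w : p w <= 1.
Proof.
by rewrite -lee_fin -cyl_massE; apply: probability_le1; exact: measurable_cylinder.
Qed.

Lemma cyl_mass_nil : p [::] = 1.
Proof.
rewrite /cyl_mass (_ : cylinder [::] = setT) ?probability_setT//.
by apply/seteqP; split => x.
Qed.

Lemma mass_mem (k : nat) (r : seq (seq nat)) :
  uniq r -> (forall w, w \in r -> size w = k) ->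
  mu [set x | word x k \in r] = (\sum_(w <- r) p w)%:E.
Proof.
elim: r => [_ _|w r IH /= /andP[wr ur] szr].
  by rewrite big_nil (_ : [set _ | _] = set0) ?measure0//; apply/seteqP; split.
rewrite big_cons EFinD -IH//; last by move=> v vr; rewrite szr// inE vr orbT.
have szw : size w = k by rewrite szr// mem_head.
rewrite (_ : [set _ | _] = cylinder w `|` [set x | word x k \in r]).
  rewrite measureU//; first by congr (_ + _)%E; exact: cyl_massE.
  - exact: measurable_cylinder.
  - exact: (@measurable_word_set k (fun w => w \in r)).
  - by rewrite -subset0 => x []; rewrite /cylinder/= szw => -> wr'; rewrite wr' in wr.
apply/seteqP; rewrite /cylinder szw; split => x /=; rewrite inE.
  by move=> /orP[/eqP|]; [left|right].
by move=> [->|->]; rewrite ?eqxx ?orbT.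
Qed.

Lemma sum_words_cond N k (P : pred (seq nat)) :
  mu [set x | word x k \in words N k /\ P (word x k)]
  = (\sum_(w <- words N k | P w) p w)%:E.
Proof.
rewrite -big_filter -(@mass_mem k) ?filter_uniq ?words_uniq//; last first.
  by move=> w; rewrite mem_filter => /andP[_ /size_mem_words].
congr (mu _); apply/seteqP; split => x /=; rewrite mem_filter.
  by move=> [-> ->].
by move=> /andP[-> ->].
Qed.

Lemma cyl_mass_children N (w : seq nat) : \sum_(a < N) p (rcons w (a : nat)) <= p w.
Proof.
rewrite -(big_mkord xpredT (fun a => p (rcons w a))) /index_iota subn0.
rewrite -(big_map (rcons w) xpredT p) -lee_fin -(@mass_mem (size w).+1).
- rewrite -cyl_massE; apply: le_measure; rewrite ?inE.
  + exact: (@measurable_word_set (size w).+1 (fun w => w \in _)).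
  + exact: measurable_cylinder.
  + move=> x /= /mapP[a _ xwa]; rewrite /cylinder/=.
    by rewrite -(take_word x (leqnSn _)) xwa -cats1 take_size_cat.
- by rewrite map_inj_uniq ?iota_uniq//; exact: rcons_injr.
- by move=> _ /mapP[a _ ->]; rewrite size_rcons.
Qed.

Lemma cyl_mass_cat_le u v : p (u ++ v) <= p u.
Proof.
by apply: fine_mu_le; [exact: measurable_cylinder..|move=> x /cylinder_cat[]].
Qed.

Lemma sum_words_le1 N k : \sum_(w <- words N k) p w <= 1.
Proof.
rewrite -lee_fin -(@mass_mem k) ?words_uniq//; last exact: size_mem_words.
apply: probability_le1; exact: (@measurable_word_set k (fun w => w \in _)).
Qed.

(** Tightness in the infinite alphabet: each prefix of length [k] uses only finitely many letters,
    and [mu] is continuous from below. *)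
Lemma sum_words_cvg1 k (e : R) : 0 < e ->
  exists N0, forall N, (N0 <= N)%N -> 1 - e < \sum_(w <- words N k) p w.
Proof.
move=> e0; pose F N : set borel_shift_space := [set x | word x k \in words N k].
have mF N : measurable (F N) by exact: (@measurable_word_set k (fun w => w \in _)).
have FT : \bigcup_N F N = setT.
  apply/seteqP; split => // x _; exists (\max_(a <- word x k) a.+1)%N => //=.
  by have := words_wide (leqnn (\max_(a <- word x k) a.+1)); rewrite size_word.
have FN : {homo F : m n / (m <= n)%N >-> (m <= n)%O}.
  by move=> m n mn; apply/subsetPset => x; apply: words_subset.
have mFT : measurable (\bigcup_N F N) by rewrite FT; exact: measurableT.
have muF : mu (\bigcup_N F N) = 1%E by rewrite FT probability_setT.
have := nondecreasing_cvg_mu mF mFT FN (mu := mu).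
rewrite [X in _ --> X]muF => cvF.
case: (cvF [set y : \bar R | (1 - e)%:E < y]%E).
  by apply: open_ereal_gt'; rewrite lte_fin; lra.
move=> N0 _ HN; exists N0 => N NN0.
have := HN N NN0; rewrite /=/F (@mass_mem k) ?words_uniq ?lte_fin//.
exact: size_mem_words.
Qed.

Lemma mu_shift_word_set (i k : nat) (P : seq nat -> Prop) : shift_invariant mu ->
  mu [set x | P (word (iter i shift x) k)] = mu [set x | P (word x k)].
Proof.
move=> inv; elim: i => //= i <-.
rewrite -(inv [set x | P (word (iter i shift x) k)]).
  by congr (mu _); apply/seteqP; split => x /=; rewrite -iterSr.
rewrite (_ : [set _ | _] = [set x | P (drop i (word x (i + k)))]).
  exact: (@measurable_word_set (i + k) (fun w => P (drop i w))).
by apply/seteqP; split => x /=; rewrite word_add drop_size_cat ?size_word.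
Qed.

Lemma continuous_measurable (f : shift_space -> R) : continuous f ->
  measurable_fun setT (f : borel_shift_space -> R).
Proof.
move=> cf; apply: (measurability _ (measurable_realfun.RGenOpens.measurableE R)).
move=> _ [_ [a [b ->] <-]]; rewrite setTI; apply: sub_sigma_algebra.
by move/continuousP: cf; apply; exact: interval_open.
Qed.

Lemma continuous_integrable (f : shift_space -> R) : continuous f -> bounded_fun f ->
  mu.-integrable setT (EFin \o (f : borel_shift_space -> R)).
Proof.
move=> cf bf; apply: measurable_bounded_integrable => //.
- by rewrite (le_lt_trans (probability_le1 _ _))// ltry.
- exact: continuous_measurable.
Qed.

Lemma integrable_cyl_sum (r : seq (seq nat)) (a : seq nat -> R) :
  mu.-integrable setT (EFin \o
    (fun x : borel_shift_space => \sum_(w <- r) a w * \1_(cylinder w) x)).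
Proof.
elim: r => [|w r IH].
  apply: (eq_integrable _ (cst 0%E)) => //; last exact: integrable0.
  by move=> x _; rewrite /= big_nil.
apply: (eq_integrable _ ((fun x : borel_shift_space => (a w)%:E * (\1_(cylinder w) x)%:E) \+
  (EFin \o (fun x : borel_shift_space => (\sum_(w <- r) a w * \1_(cylinder w) x)%R)))%E) => //.
  by move=> x _ /=; rewrite big_cons EFinD EFinM.
apply: integrableD => //; apply: integrableZl => //.
exact: integrable_indic (measurable_cylinder w).
Qed.

Lemma Rintegral_cyl_sum (r : seq (seq nat)) (a : seq nat -> R) :
  \int[mu]_x (\sum_(w <- r) a w * \1_(cylinder w) x) = \sum_(w <- r) a w * p w.
Proof.
elim: r => [|w r IH].
  under eq_Rintegral do rewrite big_nil.
  by rewrite Rintegral_cst// mul0r big_nil.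
under eq_Rintegral do rewrite big_cons.
have mw := measurable_cylinder w.
have iw := integrable_indic mu mw.
rewrite RintegralD//; first last.
- exact: integrable_cyl_sum.
- by have := integrableZl measurableT (a w) iw; apply: eq_integrable.
rewrite big_cons IH RintegralZl//; congr (_ * _ + _).
by rewrite /Rintegral integral_indic// setIT.
Qed.

End Mass.

(** * Quasi-multiplicativity of Gibbs measures *)

Lemma birkhoff_sum_add (R : realType) (f : shift_space -> R) m n x :
  birkhoff_sum f (m + n) x = birkhoff_sum f m x + birkhoff_sum f n (iter m shift x).
Proof.
rewrite /birkhoff_sum (big_cat_nat _ (leq_addr n m))//=; congr (_ + _).
rewrite -[X in index_iota X _](add0n m) big_addn addKn; apply: eq_bigr => i _.
by rewrite iterD.
Qed.

Definition quasi_bernoulli (R : realType) (nu : probability borel_shift_space R) (K : R) :=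
  [/\ 1 <= K, forall w, 0 < cyl_mass nu w,
    forall u v, cyl_mass nu (u ++ v) <= K * (cyl_mass nu u * cyl_mass nu v)
  & forall u v, cyl_mass nu u * cyl_mass nu v <= K * cyl_mass nu (u ++ v)].

(** Exponentials of Birkhoff sums are exactly multiplicative along a point of [cylinder (u ++ v)].
    Passing to masses costs a factor [C] for each of the three words, whence [C ^+ 3]. *)
Lemma gibbs_quasi_bernoulli (R : realType) (phi : shift_space -> R)
    (nu : probability borel_shift_space R) :
  gibbs phi nu -> exists K, quasi_bernoulli nu K.
Proof.
move=> [_ [C [P [C1 HC]]]]; have C0 : 0 < C by exact: lt_trans C1.
pose E n x := expR (birkhoff_sum phi n x - n%:R * P).
have E_add m n x : E (m + n)%N x = E m x * E n (iter m shift x).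
  rewrite /E -expRD birkhoff_sum_add; congr expR; rewrite natrD; ring.
have E_gt0 n x : 0 < E n x by exact: expR_gt0.
have qE n x : cyl_mass nu (word x n) <= C * E n x /\ E n x <= C * cyl_mass nu (word x n).
  (* The Gibbs bounds are only given for positive lengths; for the empty word both quantities equal
     1. *)
  have [->|n0] := posnP n.
    rewrite /E /word /= cyl_mass_nil /birkhoff_sum big_geq// mul0r subrr expR0.
    by rewrite mulr1 (ltW C1).
  have /andP[lo hi] := HC n x n0; split; first by rewrite -ler_pdivrMr.
  by move: lo; rewrite ler_pdivlMr ?expR_gt0// ler_pdivrMl.
have q_gt0 w : 0 < cyl_mass nu w.
  rewrite -[w]word_pad -(@pmulr_rgt0 _ C)//.
  by apply: lt_le_trans (E_gt0 _ _) (qE _ _).2.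
have words2 u v : exists x, [/\ word x (size u + size v) = u ++ v,
    word x (size u) = u & word (iter (size u) shift x) (size v) = v].
  have := word_pad (u ++ v); rewrite size_cat => Huv; exists (pad (u ++ v)).
  move: (Huv); rewrite word_add => /eqP.
  by rewrite eqseq_cat ?size_word// => /andP[/eqP -> /eqP ->].
exists (C ^+ 3); split => //; first by rewrite exprn_ege1// ltW.
- move=> u v; have [x [xuv xu xv]] := words2 u v.
  have [+ _] := qE (size u + size v)%N x; rewrite xuv E_add => /le_trans; apply.
  have [_ +] := qE (size u) x; have [_ +] := qE (size v) (iter (size u) shift x).
  rewrite xu xv => Ev Eu; rewrite exprS -mulrA ler_pM2l//.
  by rewrite expr2 mulrACA ler_pM// ltW.
- move=> u v; have [x [xuv xu xv]] := words2 u v.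
  have [+ _] := qE (size u) x; have [+ _] := qE (size v) (iter (size u) shift x).
  have [_ +] := qE (size u + size v)%N x; rewrite xuv xu xv E_add => Euv Ev Eu.
  have := ler_pM (ltW (q_gt0 u)) (ltW (q_gt0 v)) Eu Ev.
  move=> /le_trans; apply; rewrite mulrACA.
  by rewrite (_ : C ^+ 3 * _ = C * C * (C * cyl_mass nu (u ++ v))) ?ler_pM2l ?mulr_gt0//; ring.
Qed.

Section QuasiBernoulli.
Variables (R : realType) (nu : probability borel_shift_space R) (K : R).
Hypothesis qb : quasi_bernoulli nu K.
Local Notation q := (cyl_mass nu).

(** A word [rcons w a] shares the mass of [w] with a sibling ending in 0 or 1, and this sibling
    keeps at least the proportion [c / K]. *)
Lemma qb_decay : exists theta, 0 < theta < 1 /\ forall w, q w <= theta ^+ size w.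
Proof.
case: qb => K1 q0 _ hi; pose c := Num.min (q [:: 0%N]) (q [:: 1%N]).
have c0 : 0 < c by rewrite lt_min !q0.
have K0 : 0 < K by exact: lt_le_trans K1.
(* The letters 0 and 1 have total mass at most 1, so [c] is at most 1/2 and [1 - c / K] is
   positive. *)
have c1 : c / K <= 2^-1.
  rewrite ler_pdivrMr// (@le_trans _ _ 2^-1)//; last by rewrite ler_peMr.
  have := cyl_mass_children nu 2 [::]; rewrite big_ord_recl big_ord1 /= cyl_mass_nil.
  have : c <= q [:: 0%N] by rewrite ge_min lexx.
  have : c <= q [:: 1%N] by rewrite ge_min lexx orbT.
  by rewrite /bump /=; lra.
have cK0 : 0 < c / K by rewrite divr_gt0.
exists (1 - c / K); split; first by apply/andP; split; lra.
elim/last_ind => [|w a IH]; first by rewrite cyl_mass_nil.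
rewrite size_rcons exprSr.
suff : q (rcons w a) <= q w * (1 - c / K).
  by move=> /le_trans; apply; rewrite ler_wpM2r//; lra.
pose b : nat := if a == 0%N then 1%N else 0%N.
have ab : a != b by rewrite /b; case: (a).
have qb1 : q w * (c / K) <= q (rcons w b).
  rewrite mulrA ler_pdivrMr// [_ * K]mulrC -cats1; apply: le_trans (hi _ _).
  rewrite ler_pM2l// /c /b; case: ifP => _; by rewrite ge_min lexx ?orbT.
suff : q (rcons w a) + q (rcons w b) <= q w by lra.
have N_wide : [/\ a < (maxn a b).+1 & b < (maxn a b).+1]%N by rewrite !ltnS leq_maxl leq_maxr.
case: N_wide => aN bN.
apply: le_trans (cyl_mass_children nu (maxn a b).+1 w).
rewrite (bigD1 (Ordinal aN))//= lerD2l (bigD1 (Ordinal bN)) /=; last first.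
  by rewrite eq_sym -val_eqE.
by rewrite lerDl sumr_ge0// => i _; exact: cyl_mass_ge0.
Qed.

End QuasiBernoulli.

(** * Generic points and frequencies of words *)

Section Criterion.
Variables (R : realType) (mu : probability borel_shift_space R).
Local Notation p := (cyl_mass mu).

Lemma Rintegral_affine_cyl_sum (c : R) (r : seq (seq nat)) (a : seq nat -> R) :
  \int[mu]_x (c + \sum_(w <- r) a w * \1_(cylinder w) x) = c + \sum_(w <- r) a w * p w.
Proof.
rewrite RintegralD//.
- rewrite Rintegral_cyl_sum Rintegral_cst//.
  by rewrite [X in fine X](_ : _ = 1%E) ?mulr1//; exact: probability_setT.
- exact: finite_measure_integrable_cst.
- exact: integrable_cyl_sum.
Qed.

Lemma integrable_affine_cyl_sum (c : R) (r : seq (seq nat)) (a : seq nat -> R) :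
  mu.-integrable setT (EFin \o
    (fun x : borel_shift_space => c + \sum_(w <- r) a w * \1_(cylinder w) x)).
Proof.
apply: (eq_integrable _ ((cst c%:E) \+ (EFin \o
    (fun x : borel_shift_space => (\sum_(w <- r) a w * \1_(cylinder w) x)%R)))%E) => //.
apply: integrableD => //; last exact: integrable_cyl_sum.
exact: finite_measure_integrable_cst.
Qed.

Lemma cyl_sumE (k : nat) (r : seq (seq nat)) (a : seq nat -> R) x :
  uniq r -> (forall w, w \in r -> size w = k) ->
  \sum_(w <- r) a w * \1_(cylinder w) x
  = if word x k \in r then a (word x k) else 0.
Proof.
move=> ur szr; have szx w : w \in r -> (x \in cylinder w) = (w == word x k).
  move=> /szr szw; apply/idP/eqP => [|->]; first by rewrite inE /cylinder/= szw.
  by rewrite inE /cylinder/= size_word.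
rewrite big_seq; under eq_bigr => w wr do rewrite indicE szx//.
rewrite -big_seq; case: ifPn => xr.
  rewrite (bigD1_seq (word x k))//= eqxx mulr1 big1 ?addr0// => w /negbTE ->.
  by rewrite mulr0.
rewrite big_seq big1// => w wr; case: eqP => [wx|_]; last by rewrite mulr0.
by rewrite wx (negbTE xr) in wr.
Qed.

Lemma birkhoff_sum_le (f g : shift_space -> R) n x :
  (forall y, f y <= g y) -> birkhoff_sum f n x <= birkhoff_sum g n x.
Proof. by move=> fg; apply: ler_sum. Qed.

Lemma birkhoff_sum_affine (c : R) (r : seq (seq nat)) (a : seq nat -> R) n x :
  birkhoff_sum (fun y => c + \sum_(w <- r) a w * \1_(cylinder w) y) n x
  = n%:R * c + \sum_(w <- r) a w * birkhoff_sum \1_(cylinder w) n x.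
Proof.
rewrite /birkhoff_sum big_split/= sumr_const_nat subn0 mulr_natl; congr (_ + _).
by rewrite exchange_big/=; apply: eq_bigr => w _; rewrite mulr_sumr.
Qed.

(** By continuity, the points on whose [k]-cylinder [f] oscillates by at most [e] exhaust the space
    as [k] grows. Restricting to a finite alphabet then loses little mass. *)
Lemma oscillation_words (f : shift_space -> R) (e : R) : continuous f -> 0 < e ->
  exists k r, [/\ uniq r, forall w, w \in r -> size w = k,
    1 - e < \sum_(w <- r) p w
  & forall x y, word x k \in r -> word x k = word y k -> `|f x - f y| <= e].
Proof.
move=> cf e0; have e20 : 0 < e / 2 by lra.
pose V k (w : seq nat) := forall y z, word y k = w -> word z k = w -> `|f y - f z| <= e.
pose F k : set borel_shift_space := [set x | V k (word x k)].
have mF k : measurable (F k) by exact: (@measurable_word_set k (V k)).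
have FT : \bigcup_k F k = setT.
  apply/seteqP; split => // x _.
  have : nbhs x (f @^-1` ball (f x) (e / 2)) by apply: cf; exact: nbhsx_ballx.
  move=> /nbhs_word[k Hk]; exists k => // y z yx zx.
  have := Hk _ yx; have := Hk _ zx; rewrite /ball/= => fz fy.
  rewrite (_ : f y - f z = (f x - f z) - (f x - f y)); last by ring.
  by rewrite (le_trans (ler_normB _ _))//; lra.
have FN : {homo F : m n / (m <= n)%N >-> (m <= n)%O}.
  move=> m n mn; apply/subsetPset => x Fx y z yx zx; apply: Fx.
    by rewrite -(take_word y mn) yx take_word.
  by rewrite -(take_word z mn) zx take_word.
have mFT : measurable (\bigcup_N F N) by rewrite FT; exact: measurableT.
have muF : mu (\bigcup_N F N) = 1%E by rewrite FT probability_setT.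
have := nondecreasing_cvg_mu mF mFT FN (mu := mu).
rewrite [X in _ --> X]muF => cvF.
case: (cvF [set y : \bar R | (1 - e / 2)%:E < y]%E).
  by apply: open_ereal_gt'; rewrite lte_fin; lra.
move=> k _ /(_ k (leqnn k)) /= Fk.
have [N /(_ N (leqnn N)) HN] := sum_words_cvg1 mu k e20.
exists k, [seq w <- words N k | `[< V k w >]]; split.
- by rewrite filter_uniq// words_uniq.
- by move=> w; rewrite mem_filter => /andP[_ /size_mem_words].
- rewrite big_filter; move: HN; rewrite (bigID (fun w => `[< V k w >]))/=.
  suff : \sum_(w <- words N k | ~~ `[< V k w >]) p w < e / 2 by lra.
  rewrite -lte_fin -sum_words_cond.
  apply: (@le_lt_trans _ _ (mu (~` F k))).
    apply: le_measure; rewrite ?inE.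
    + exact: (@measurable_word_set k (fun w => w \in words N k /\ ~~ `[< V k w >])).
    + exact: measurableC.
    + by move=> x /= [_ /asboolPn].
  rewrite probability_setC// lteBlDr ?mu_fin//.
  by rewrite -lteBlDl// -EFinB.
- move=> x y; rewrite mem_filter => /andP[/asboolP Vx _] xy.
  by apply: Vx.
Qed.

(* [f] need not be uniformly continuous: it is approximated by a locally constant function
   off a set of small measure, whose visits are controlled by the frequencies too. *)
Lemma generic_of_frequencies (x : shift_space) :
  (forall w (e : R), 0 < e -> exists n0, forall n, (n0 <= n)%N ->
     `|birkhoff_sum \1_(cylinder w) n x - n%:R * p w| <= e * n%:R) ->
  generic_points mu x.
Proof.
move=> freq f cf bf.
have [B B0 fB] : exists2 B, 0 < B & forall y, `|f y| <= B.
  have [B B0 HB] := ex_strict_bound_gt0 bf.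
  by exists B => // y; apply/ltW/HB.
(* In the error, [2 * e] comes from the oscillation of [f], and [4 * B * e] from the mass missed by
   [r] and from the errors in the frequencies. *)
suff main e : 0 < e -> exists n0, forall n, (n0 <= n)%N ->
    `|birkhoff_sum f n x - n%:R * \int[mu]_y f y| <= e * (2 + 4 * B) * n%:R.
  apply/cvgrPdist_le => /= e e0.
  have B1 : 0 < 2 + 4 * B by lra.
  have [n0 Hn] := main (e / (2 + 4 * B)) (divr_gt0 e0 B1).
  exists n0.+1 => // n /= n0n; have n1 : (0 < n)%N by exact: leq_ltn_trans n0n.
  have := Hn n (ltnW n0n); rewrite divfK ?gt_eqF// => H.
  have nR : 0 < n%:R :> R by rewrite ltr0n.
  rewrite distrC -(ler_pM2l nR) -{1}(gtr0_norm nR) -normrM mulrBr mulVKf ?gt_eqF//.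
  by rewrite [n%:R * e]mulrC.
move=> e0; have [k [r [ur szr Hr osc]]] := oscillation_words cf e0.
pose S w n := birkhoff_sum (\1_(cylinder w) : shift_space -> R) n x.
have [n0 Hn0] : exists n0, forall n, (n0 <= n)%N ->
    \sum_(w <- r) `|S w n - n%:R * p w| <= e * n%:R.
  have : forall e', 0 < e' -> exists n0, forall n, (n0 <= n)%N ->
    \sum_(w <- r) `|S w n - n%:R * p w| <= e' * n%:R.
    elim: (r) => [e' e'0|w r' IH e' e'0].
      by exists 0%N => n _; rewrite big_nil mulr_ge0// ltW.
    have e2 : 0 < e' / 2 by lra.
    have [n1 H1] := freq w _ e2; have [n2 H2] := IH _ e2.
    exists (maxn n1 n2) => n; rewrite geq_max => /andP[/H1 h1 /H2 h2].
    by rewrite big_cons (_ : e' * _ = e' / 2 * n%:R + e' / 2 * n%:R) ?lerD//; field.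
  by apply.
exists n0 => n /Hn0 {}Hn0.
pose a w := f (pad w); pose d := \sum_(w <- r) p w.
have aB w : `|a w| <= B by exact: fB.
(* The right-hand side is [a w + e] on the cylinders of [r] and [e + B] elsewhere; the minorant
   below is symmetric. *)
have up y : f y <= (e + B) + \sum_(w <- r) (a w - B) * \1_(cylinder w) y.
  rewrite (cyl_sumE _ _ ur szr); case: ifPn => yr.
    have := osc y (pad (word y k)) yr (esym (word_pad_word y k)).
    by rewrite ler_norml /a => /andP[_]; lra.
  by have := fB y; rewrite ler_norml => /andP[_]; lra.
have lo y : - (e + B) + \sum_(w <- r) (a w + B) * \1_(cylinder w) y <= f y.
  rewrite (cyl_sumE _ _ ur szr); case: ifPn => yr.
    have := osc y (pad (word y k)) yr (esym (word_pad_word y k)).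
    by rewrite ler_norml /a => /andP[]; lra.
  by have := fB y; rewrite ler_norml => /andP[]; lra.
have fint := continuous_integrable mu cf bf.
have Iup : \int[mu]_y f y <= (e + B) + \sum_(w <- r) (a w - B) * p w.
  rewrite -Rintegral_affine_cyl_sum; apply: le_Rintegral => //.
  exact: integrable_affine_cyl_sum.
have Ilo : - (e + B) + \sum_(w <- r) (a w + B) * p w <= \int[mu]_y f y.
  rewrite -Rintegral_affine_cyl_sum; apply: le_Rintegral => //.
  exact: integrable_affine_cyl_sum.
have Sup := birkhoff_sum_le n x up; have Slo := birkhoff_sum_le n x lo.
rewrite !birkhoff_sum_affine in Sup Slo.
have nR : 0 <= n%:R :> R by [].
pose A := \sum_(w <- r) a w * p w; pose As := \sum_(w <- r) a w * S w n.
pose D := \sum_(w <- r) S w n.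
have split1 (F : seq nat -> R) b : \sum_(w <- r) (a w + b) * F w =
    \sum_(w <- r) a w * F w + b * \sum_(w <- r) F w.
  by rewrite mulr_sumr -big_split/=; apply: eq_bigr => w _; rewrite mulrDl.
rewrite !split1 in Sup Slo Iup Ilo.
have D_near : `|D - n%:R * d| <= e * n%:R.
  rewrite /D /d mulr_sumr -sumrB; apply: le_trans Hn0.
  exact: ler_norm_sum.
have A_near : `|As - n%:R * A| <= B * (e * n%:R).
  rewrite /As /A mulr_sumr -sumrB; apply: le_trans (ler_norm_sum _ _ _) _.
  apply: (@le_trans _ _ (\sum_(w <- r) B * `|S w n - n%:R * p w|)).
    apply: ler_sum => w _; rewrite (_ : _ - _ = a w * (S w n - n%:R * p w)); last by ring.
    by rewrite normrM ler_wpM2r.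
  by rewrite -mulr_sumr ler_pM2l.
have d1 : 1 - e < d by [].
rewrite -/A -/d in Iup Ilo; rewrite -/As -/D in Sup Slo.
move: D_near A_near; rewrite !ler_norml => /andP[D1 D2] /andP[A1 A2].
have nB : 0 <= B * n%:R by rewrite mulr_ge0// ltW.
have := ler_wpM2l nR Iup; have := ler_wpM2l nR Ilo.
have := ler_wpM2l nB (ltW d1).
have := ler_wpM2l (ltW B0) D1; have := ler_wpM2l (ltW B0) D2.
clear -Sup Slo A1 A2; move: (\int[mu]_y f y) => I.
by move=> h1 h2 h3 h4 h5; apply/andP; split; nra.
Qed.

End Criterion.

Lemma limn_esup_ltP (R : realType) (u : nat -> \bar R) (c : \bar R) :
  (limn_esup u < c)%E -> exists n0, forall n, (n0 <= n)%N -> (u n < c)%E.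
Proof.
rewrite /limn_esup limf_esupE => /ereal_inf_lt[_ [V [n0 _ n0V] <-] supV].
exists n0 => n n0n; apply: le_lt_trans supV; apply: ereal_sup_ubound.
by exists n => //; apply: n0V.
Qed.

Lemma lt_limn_esupP (R : realType) (u : nat -> \bar R) (c : \bar R) :
  (c < limn_esup u)%E -> forall n0, exists2 n, (n0 <= n)%N & (c < u n)%E.
Proof.
rewrite /limn_esup limf_esupE => cu n0; apply: contrapT => Hn.
move: cu; rewrite ltNge => /negP; apply.
apply: (@le_trans _ _ (ereal_sup [set u x | x in [set n | (n0 <= n)%N]])).
  apply: ereal_inf_lbound; exists [set n | (n0 <= n)%N] => //.
  by exists n0.
apply: ge_ereal_sup => _ [n n0n <-]; rewrite leNgt; apply/negP => cun.
by apply: Hn; exists n.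
Qed.

(** * Upper bound *)

Section Covers.
Variables (R : realType) (nu : probability borel_shift_space R).
Local Notation q := (cyl_mass nu).

Lemma cyl_dist_le (w : seq nat) x y :
  cylinder w x -> cylinder w y -> cyl_dist nu x y <= q w.
Proof.
move=> wx wy; rewrite /cyl_dist; case: pselect => [xy|_]; last exact: cyl_mass_ge0.
case: ex_minnP => k /eqP xyk _; have kw : (size w <= k)%N.
  rewrite leqNgt; apply/negP => kw; apply: xyk.
  by have [_] := eq_word x y (size w); apply => //; rewrite wx wy.
by rewrite -(subnKC kw) word_add wx cyl_mass_cat_le.
Qed.

Lemma diam_ge0 (T : Type) (d : T -> T -> R) (U : set T) : (0 <= diam d U)%E.
Proof. by rewrite /diam le_max lexx. Qed.

Lemma diam_set0 (T : Type) (d : T -> T -> R) : diam d set0 = 0%E.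
Proof.
rewrite /diam (_ : [set _ | _] = set0) ?ereal_sup0 ?max_l ?leNye//.
by apply/seteqP; split => // e [x [y []]].
Qed.

Lemma diam_cylinder (w : seq nat) : (diam (cyl_dist nu) (cylinder w) <= (q w)%:E)%E.
Proof.
rewrite /diam ge_max lee_fin cyl_mass_ge0/=; apply: ge_ereal_sup => _ [x [y [wx wy ->]]].
by rewrite lee_fin cyl_dist_le.
Qed.

Lemma poweR_diam_cylinder (w : seq nat) (s : R) : 0 < s ->
  (poweR (diam (cyl_dist nu) (cylinder w)) s <= (q w `^ s)%:E)%E.
Proof.
move=> s0; rewrite -poweR_EFin; apply: gt0_ler_poweR (diam_cylinder w) => //.
- exact: ltW.
- by rewrite in_itv/= diam_ge0 leey.
- by rewrite in_itv/= lee_fin cyl_mass_ge0 leey.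
Qed.

(** Exponential decay makes long cylinders small in diameter, so covers by long words suffice;
    bounds on finite subfamilies pass to the series. *)
Lemma hausdorff_measure_zero (theta s : R) (A : set shift_space) :
  0 < theta < 1 -> (forall w, q w <= theta ^+ size w) -> 0 < s ->
  (forall (e : R) n0, 0 < e -> exists G : pred (seq nat),
    [/\ forall w, G w -> (n0 <= size w)%N,
        forall x, A x -> exists n, G (word x n)
      & forall r, uniq r -> all G r -> \sum_(w <- r) q w `^ s <= e]) ->
  hausdorff_measure (cyl_dist nu) s A = 0%E.
Proof.
move=> /andP[th0 th1] qth s0 cov.
have pre_ge0 dl : (0 <= hausdorff_premeasure (cyl_dist nu) s dl A)%E.
  apply: le_ereal_inf_tmp => _ [U _ <-]; apply: nneseries_ge0 => i _ _.
  exact: poweR_ge0.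
have pre_le0 dl : 0 < dl -> (hausdorff_premeasure (cyl_dist nu) s dl A <= 0)%E.
  move=> dl0; apply/lee_addgt0Pr => e e0; rewrite add0e.
  have [n0 Hn0] : exists n0, theta ^+ n0 <= dl.
    have : theta ^+ n @[n --> \oo] --> 0 by apply: cvg_expr; rewrite ger0_norm ?ltW.
    move=> /cvgrPdist_le/(_ dl dl0)[n0 _ /(_ n0 (leqnn n0))].
    by rewrite /= sub0r normrN => /(le_trans (ler_norm _)) ?; exists n0.
  have [G [Gn0 GA Gsum]] := cov e n0 e0.
  (* The words of [G] are enumerated by their codes; an index that codes no word of [G] contributes
     the empty set. *)
  pose w_ i : option (seq nat) := obind (fun w => if G w then Some w else None) (pickle_inv i).
  pose U i := if w_ i is Some w then cylinder w else set0.
  have w_G i w : w_ i = Some w -> G w.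
    by rewrite /w_; case: pickle_inv => //= v; case: ifP => // Gv [<-].
  apply: (@le_trans _ _ (\sum_(0 <= i <oo) poweR (diam (cyl_dist nu) (U i)) s)%E).
    apply: ereal_inf_lbound; exists U => //; split => [x Ax|i].
      have [n Gn] := GA x Ax; exists (pickle (word x n)) => //.
      by rewrite /U /w_ pickleK_inv/= Gn /cylinder/= size_word.
    rewrite /U; case E : (w_ i) => [w|]; last by rewrite diam_set0 lee_fin ltW.
    apply: le_trans (diam_cylinder w) _; rewrite lee_fin.
    apply: le_trans (qth w) (le_trans _ Hn0).
    by apply: ler_wiXn2l; [exact: ltW|exact: ltW|exact: Gn0 (w_G _ _ E)].
  apply: lime_le.
    by apply: is_cvg_nneseries => i _ _; exact: poweR_ge0.
  apply: nearW => n.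
  have ur : uniq (pmap w_ (iota 0 n)).
    apply: (@pmap_uniq _ _ _ pickle); last exact: iota_uniq.
    move=> i; rewrite /w_; have := @pickle_invK (seq nat) i; rewrite /=.
    by case: pickle_inv => //= w; case: ifP.
  have Gr : all G (pmap w_ (iota 0 n)).
    by apply/allP => w; rewrite mem_pmap => /mapP[i _ /esym/w_G].
  apply: le_trans (_ : (\sum_(w <- pmap w_ (iota 0 n)) q w `^ s)%:E <= _)%E; last first.
    by rewrite lee_fin Gsum.
  rewrite /index_iota subn0; elim: (iota 0 n) => [|i l IH]; first by rewrite !big_nil.
  rewrite big_cons /=; rewrite /U; case: (w_ i) => [w|] /=.
    by rewrite big_cons EFinD; apply: leeD => //; exact: poweR_diam_cylinder.
  by rewrite diam_set0 poweR0r ?gt_eqF// add0e.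
rewrite /hausdorff_measure; apply/eqP; rewrite eq_le; apply/andP; split.
  by apply: ge_ereal_sup => _ [dl dl0 <-]; exact: pre_le0.
by apply: le_trans (pre_ge0 1) _; apply: ereal_sup_ubound; exists 1 => /=.
Qed.

End Covers.

(** * Weighted covers of the generic points *)

Section Upper.
Variables (R : realType) (mu nu : probability borel_shift_space R) (K : R).
Hypothesis qb : quasi_bernoulli nu K.
Local Notation p := (cyl_mass mu).
Local Notation q := (cyl_mass nu).

Let K1 : 1 <= K. Proof. by case: qb. Qed.
Let K0 : 0 < K. Proof. exact: lt_le_trans K1. Qed.
Let q0 w : 0 < q w. Proof. by case: qb. Qed.
Let qM u v : q (u ++ v) <= K * (q u * q v). Proof. by case: qb. Qed.

Lemma powR_qM (s : R) u v : 0 <= s -> q (u ++ v) `^ s <= K `^ s * (q u `^ s * q v `^ s).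
Proof.
move=> s0; rewrite -!powRM ?mulr_ge0 ?cyl_mass_ge0 ?(ltW K0)//.
by apply: ge0_ler_powR; rewrite ?nnegrE ?mulr_ge0 ?cyl_mass_ge0 ?(ltW K0)//.
Qed.

Lemma letter_sum_bounded (s : R) : (conv_exponent nu < s%:E)%E ->
  0 < s /\ exists S, forall N, \sum_(w <- words N 1) q w `^ s <= S.
Proof.
move=> /ereal_inf_lt[_ [t [t0 tfin] <-]]; rewrite lte_fin => ts; split.
  exact: lt_trans ts.
have ge0 (n : nat) : (0 <= (q [:: n] `^ t)%:E)%E by rewrite lee_fin powR_ge0.
have Sfin : (\sum_(0 <= n <oo) (q [:: n] `^ t)%:E)%E \is a fin_num.
  by rewrite ge0_fin_numE// nneseries_ge0.
exists (fine (\sum_(0 <= n <oo) (q [:: n] `^ t)%:E)%E) => N.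
rewrite sum_words1; apply: (@le_trans _ _ (\sum_(a < N) q [:: (a : nat)] `^ t)).
  apply: ler_sum => a _; apply: ger_powR (ltW ts).
  by rewrite q0 cyl_mass_le1.
rewrite -lee_fin fineK//.
rewrite -(big_mkord xpredT (fun a => q [:: a] `^ t)) -sumEFin.
by apply: nneseries_lim_ge.
Qed.

Lemma words_sum_bounded (s : R) : (conv_exponent nu < s%:E)%E ->
  forall k, exists T, forall j N, (j <= k)%N -> \sum_(w <- words N j) q w `^ s <= T.
Proof.
move=> /letter_sum_bounded[s0 [S HS]]; elim=> [|k [T HT]].
  exists 1 => j N; rewrite leqn0 => /eqP ->.
  by rewrite big_seq1 cyl_mass_nil powR1.
exists (T + K `^ s * (S * T)) => j N.
have T0 : 0 <= T.
  by apply: le_trans (HT 0%N 0%N _); rewrite ?sumr_ge0// => *; exact: powR_ge0.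
have S0 : 0 <= S.
  by apply: le_trans (HS 0%N); rewrite sumr_ge0// => *; exact: powR_ge0.
have P0 : 0 <= K `^ s * (S * T) by rewrite !mulr_ge0// powR_ge0.
rewrite leq_eqVlt => /predU1P[->|jk]; last by have := HT j N jk; lra.
rewrite -add1n sum_words_add.
apply: (@le_trans _ _ (K `^ s * (S * T))); last by rewrite lerDr.
apply: (@le_trans _ _ (K `^ s * ((\sum_(u <- words N 1) q u `^ s) *
  (\sum_(v <- words N k) q v `^ s)))).
  rewrite mulr_suml mulr_sumr; apply: ler_sum => u _.
  rewrite mulr_sumr mulr_sumr; apply: ler_sum => v _.
  exact: powR_qM (ltW s0).
rewrite ler_pM2l ?powR_gt0//; apply: ler_pM (HS N) (HT k N (leqnn k)).
  by rewrite sumr_ge0// => *; exact: powR_ge0.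
by rewrite sumr_ge0// => *; exact: powR_ge0.
Qed.

(** The sums over [words N k] are bounded and increase with [N], so from some [N0] on they are
    within 1 of their supremum. *)
Lemma words_sum_tail (s : R) k : (conv_exponent nu < s%:E)%E ->
  exists N0, forall N N', (N0 <= N)%N -> (N <= N')%N ->
    \sum_(w <- words N' k | w \notin words N k) q w `^ s <= 1.
Proof.
move=> /words_sum_bounded/(_ k)[T HT].
pose E := range (fun N => \sum_(w <- words N k) q w `^ s).
have supE : has_sup E.
  by split; [exists (\sum_(w <- words 0 k) q w `^ s); exists 0%N|exists T => _ [N _ <-]; exact: HT].
have [_ [N0 _ <-] HN0] := sup_adherent ltr01 supE.
exists N0 => N N' N0N NN'.
have lesup : \sum_(w <- words N' k) q w `^ s <= sup E.
  by apply: sup_ubound; [case: supE|exists N'].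
move: lesup; rewrite (bigID (fun w => w \notin words N k))/=.
have : \sum_(w <- words N0 k) q w `^ s <= \sum_(w <- words N' k | ~~ (w \notin words N k)) q w `^ s.
  rewrite -[in leRHS]big_filter; apply: leq_sum_subset; first exact: words_uniq.
    move=> w wN0; rewrite mem_filter negbK (words_subset N0N)//.
    by rewrite (words_subset (leq_trans N0N NN')).
  by move=> w _; exact: powR_ge0.
by move: HN0; lra.
Qed.

Lemma sum_residues (F : nat -> R) m k :
  \sum_(0 <= i < (m * k)%N) F i = \sum_(j < k) \sum_(i < m) F (j + i * k)%N.
Proof.
elim: m => [|m IH]; first by rewrite mul0n big_geq// big1// => j _; rewrite big_ord0.
rewrite mulSnr (big_cat_nat _ (leq_addr _ _))//= IH.
under [RHS]eq_bigr do rewrite big_ord_recr/=.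
rewrite big_split/=; congr (_ + _).
rewrite -[X in index_iota X _](add0n (m * k)%N) big_addn addKn big_mkord.
by apply: eq_bigr => j _.
Qed.

Fixpoint block_prod (k : nat) (g : seq nat -> R) (m : nat) (w : seq nat) : R :=
  if m is m'.+1 then g (take k w) * block_prod k g m' (drop k w) else 1.

Lemma sum_block_prod k g m N :
  \sum_(w <- words N (m * k)%N) block_prod k g m w = (\sum_(w <- words N k) g w) ^+ m.
Proof.
elim: m => [|m IH]; first by rewrite mul0n big_seq1.
rewrite mulSn sum_words_add exprS mulr_suml -IH.
apply: eq_big_seq => u /size_mem_words su; rewrite mulr_sumr.
by apply: eq_bigr => v _ /=; rewrite take_size_cat// drop_size_cat.
Qed.

Lemma block_prod_ge0 k g m w : (forall u, 0 <= g u) -> 0 <= block_prod k g m w.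
Proof. by move=> g0; elim: m w => //= m IH w; rewrite mulr_ge0. Qed.

Lemma prefix_bound (s : R) k (g : seq nat -> R) (f : shift_space -> R) m u y :
  0 <= s -> (forall w, 0 <= g w) ->
  (forall z, (K * q (word z k)) `^ s <= g (word z k) * expR (- f z)) ->
  q (u ++ word y (m * k)%N) `^ s <= q u `^ s *
    (expR (- \sum_(i < m) f (iter (i * k)%N shift y)) * block_prod k g m (word y (m * k)%N)).
Proof.
move=> s0 g_ge0 gf; elim: m u y => [|m IH] u y.
  by rewrite mul0n cats0 big_ord0 oppr0 expR0 !mulr1.
rewrite mulSn word_add catA; apply: le_trans (IH _ _) _.
rewrite /= take_size_cat ?size_word// drop_size_cat ?size_word// big_ord_recl/= ?mul0n/=.
set P := block_prod _ _ _ _; set g0 := g _.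
have P0 : 0 <= expR (- (\sum_(i < m) f (iter (i * k)%N shift (iter k shift y)))) .
  exact: expR_ge0.
have E : \sum_(i < m) f (iter (bump 0 i * k)%N shift y) =
    \sum_(i < m) f (iter (i * k)%N shift (iter k shift y)).
  by apply: eq_bigr => i _; rewrite -iterD mulSn addnC.
rewrite E opprD expRD; set X := expR (- \sum_(i < m) _); set Y := expR (- f y).
have Hq : q (u ++ word y k) `^ s <= q u `^ s * (g0 * Y).
  apply: le_trans (ler_wpM2l (powR_ge0 _ _) (gf y)).
  by rewrite powRM ?cyl_mass_ge0 ?(ltW K0)// mulrCA; exact: powR_qM.
apply: le_trans (ler_wpM2r _ Hq) _.
  by rewrite mulr_ge0 ?expR_ge0// block_prod_ge0.
by rewrite le_eqVlt (_ : _ * (X * P) = q u `^ s * (Y * X * (g0 * P))) ?eqxx//; ring.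
Qed.

Lemma entropy_ratioE k N : entropy_ratio nu mu k N =
  (\sum_(w <- words N k) p w * ln (p w)) / (\sum_(w <- words N k) p w * ln (q w)).
Proof.
rewrite -(sum_tuple_words _ _ (fun w => p w * ln (p w))).
by rewrite -(sum_tuple_words _ _ (fun w => p w * ln (q w))).
Qed.

(** Makes the denominator of [entropy_ratio] negative of order [k], so that a gap between exponents
    outweighs constant costs. *)
Lemma sum_ln_le (theta : R) k N : 0 < theta < 1 -> (forall w, q w <= theta ^+ size w) ->
  \sum_(w <- words N k) p w * ln (q w) <= (k%:R * ln theta) * \sum_(w <- words N k) p w.
Proof.
move=> /andP[th0 th1] qth; rewrite mulr_sumr big_seq [leRHS]big_seq.
apply: ler_sum => w /size_mem_words sw; rewrite [leRHS]mulrC.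
apply: ler_wpM2l; first exact: cyl_mass_ge0.
by rewrite mulr_natl -lnXn// ler_ln ?posrE ?exprn_gt0// -sw.
Qed.

Lemma continuous_word k (F : seq nat -> R) :
  continuous (fun x : shift_space => F (word x k)).
Proof. by apply/continuousP => A oA; exact: (@open_word_set k (fun w => A (F w))). Qed.

Lemma natural_large (c d : R) : 0 < c -> exists n0, forall n, (n0 <= n)%N -> d < n%:R * c.
Proof.
move=> c0; exists (Num.truncn (`|d| / c)).+1 => n n0n.
rewrite -ltr_pdivrMr//; apply: (@le_lt_trans _ _ (`|d| / c)).
  by rewrite ler_pM2r ?invr_gt0// ler_norm.
by apply: lt_le_trans (truncnS_gt _) _; rewrite ler_nat.
Qed.

Lemma lte_real_between (x : \bar R) (s : R) : (x < s%:E)%E ->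
  exists s', (x < s'%:E)%E /\ s' < s.
Proof.
case: x => [r||] //; last by move=> _; exists (s - 1); rewrite ltNyr; split => //; lra.
by rewrite lte_fin => rs; exists ((r + s) / 2); rewrite lte_fin; split; lra.
Qed.

(* [g] is [p w + 1 / #|A|] on a large finite set [A] of blocks and [q w `^ s] off it, divided
   by 3; the summand [1 / #|A|] keeps [ln g] finite where [p] vanishes. *)
Lemma block_potential (s : R) : (conv_exponent nu < s%:E)%E ->
  (relative_exponent nu mu < s%:E)%E ->
  exists k (g F : seq nat -> R), [/\ (0 < k)%N /\ (forall w, 0 <= g w),
    forall N, \sum_(w <- words N k) g w <= 1,
    forall x, (K * q (word x k)) `^ s <= g (word x k) * expR (- F (word x k)),
    bounded_fun (fun x : shift_space => F (word x k))
  & 0 < \int[mu]_x F (word x k)].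
Proof.
move=> as_ bs; have [s0 _] := letter_sum_bounded as_.
have [theta [th qth]] := qb_decay qb; have /andP[th0 th1] := th.
have lnth : ln theta < 0 by rewrite ln_lt0// th.
have [s' [bs' s's]] := lte_real_between bs.
have [k0 Hk0] := limn_esup_ltP bs'.
(* [ln K] pays for quasi-multiplicativity, [ln 3] for the normalization of the weights. *)
pose cost := s * ln K + ln 3.
have c_gt0 : 0 < (s' - s) * ln theta / 2.
  by rewrite divr_gt0// nmulr_rgt0// subr_lt0.
have [k1 Hk1] := natural_large cost c_gt0.
pose k := (maxn k0 k1).+1.
have {Hk0} := Hk0 k (leq_trans (leq_maxl _ _) (leqnSn _)).
have {Hk1} := Hk1 k (leq_trans (leq_maxr _ _) (leqnSn _)).
have : (0 < k)%N by [].
move: k => k kgt0 Hcost /limn_esup_ltP[N1 HN1].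
have [N2 HN2] := words_sum_tail k as_.
have [N3 HN3] := sum_words_cvg1 mu k (e := 2^-1) ltac:(lra).
(* [N1] puts the ratio below [s'], [N2] bounds the tail of the [s]-sums by 1, and [N3] makes the
   mass of [A] exceed 1/2. *)
pose N := maxn N1 (maxn N2 N3).
have {HN1} := HN1 N (leq_maxl _ _); rewrite lte_fin entropy_ratioE => HN1.
have {}HN2 N' := HN2 N N' (leq_trans (leq_maxl _ _) (leq_maxr _ _)).
have {HN3} := HN3 N (leq_trans (leq_maxr _ _) (leq_maxr _ _)) => HN3.
have uA := words_uniq N k; have szA := @size_mem_words N k.
have leD := sum_ln_le k N th qth; have pA1 := sum_words_le1 mu N k.
move: (words N k) HN1 HN2 HN3 uA szA leD pA1 => A.
set E := \sum_(w <- A) p w * ln (p w); set D := \sum_(w <- A) p w * ln (q w).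
set pA := \sum_(w <- A) p w => HN1 HN2 HN3 uA szA leD.
have kln : k%:R * ln theta < 0 by rewrite nmulr_llt0 ?ltr0n.
have leD2 : D <= k%:R * ln theta / 2.
  apply: le_trans leD _; have : 2^-1 < pA by lra.
  by move: (k%:R * ln theta) kln => t t0 h; nra.
have D0 : D < 0 by apply: le_lt_trans leD2 _; lra.
rewrite ltr_ndivrMr// in HN1.
(* Since [D] is negative, the ratio bound reads [s' * D < E]; hence [E - s * D] exceeds
   [(s - s') * - D], which is of order [k]. *)
have gap : cost < E - s * D.
  have : (s - s') * - (k%:R * ln theta / 2) <= (s - s') * - D.
    by rewrite ler_pM2l; lra.
  move: Hcost; rewrite (_ : k%:R * _ = (s - s') * - (k%:R * ln theta / 2)); last by field.
  by lra.
have A0 : (0 < size A)%N.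
  rewrite lt0n; apply/eqP => /size0nil A_nil.
  by move: HN3; rewrite /pA A_nil big_nil; lra.
pose iA : R := (size A)%:R^-1.
have iA0 : 0 < iA by rewrite invr_gt0 ltr0n.
pose h w := if w \in A then p w + iA else q w `^ s.
have h0 w : 0 < h w.
  rewrite /h; case: ifP => _; last exact: powR_gt0.
  by rewrite ltr_wpDl ?cyl_mass_ge0.
pose F w := ln (h w) - s * ln (q w) - cost.
(* Off [A] the logarithms cancel, so the potential is a constant plus a finite sum: bounded, with an
   explicit integral. *)
have FE x : F (word x k) = - cost + \sum_(w <- A)
    (ln (p w + iA) - s * ln (q w)) * \1_(cylinder w) x.
  rewrite (cyl_sumE _ _ uA szA) /F /h; case: ifPn => xA; first by lra.
  by rewrite ln_powR; lra.
exists k, (fun w => h w / 3), F; split.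
- by split => // w; rewrite divr_ge0 ?(ltW (h0 _)).
(* The values of [h] total at most 3: 1 off [A], and on [A] 1 for the masses and 1 for the summands
   [iA]. *)
- move=> N'; rewrite -mulr_suml ler_pdivrMr// mul1r.
  apply: (@le_trans _ _ (\sum_(w <- words (maxn N N') k) h w)).
    apply: leq_sum_subset; first exact: words_uniq.
      by move=> w; apply: words_subset; exact: leq_maxr.
    by move=> w _; exact: ltW.
  rewrite (bigID (fun w => w \notin A))/=.
  have h1 : \sum_(w <- words (maxn N N') k | w \notin A) h w <= 1.
    apply: le_trans (HN2 _ (leq_maxl N N')).
    by apply: ler_sum => w /negbTE wA; rewrite /h wA.
  suff : \sum_(w <- words (maxn N N') k | ~~ (w \notin A)) h w <= 2 by lra.
  rewrite -big_filter; apply: (@le_trans _ _ (\sum_(w <- A) h w)).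
    apply: leq_sum_subset; first by rewrite filter_uniq// words_uniq.
      by move=> w; rewrite mem_filter negbK => /andP[].
    by move=> w _; exact: ltW.
  rewrite big_seq /h; under eq_bigr => w wA do rewrite wA.
  rewrite -big_seq big_split/= -[leRHS]/(1 + 1) lerD//.
  rewrite big_const_seq count_predT iter_addr addr0.
  by rewrite -[_ *+ _]mulr_natl divff// pnatr_eq0 -lt0n.
- move=> x; move: (word x k) => w.
  have -> : - F w = s * ln (q w) + s * ln K + ln 3 - ln (h w).
    by rewrite /F /cost; ring.
  rewrite !expRD expRN !lnK ?posrE// powRM ?cyl_mass_ge0 ?(ltW K0)//.
  rewrite -!ln_powR !lnK ?posrE ?powR_gt0//.
  rewrite le_eqVlt (_ : h w / 3 * _ = K `^ s * q w `^ s) ?eqxx//.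
  by field; rewrite gt_eqF.
- exists (`|cost| + \sum_(w <- A) `|ln (p w + iA) - s * ln (q w)|).
  split; first exact: num_real.
  move=> M /ltW HM x _; apply: le_trans HM; rewrite /= FE.
   apply: le_trans (ler_normD _ _) _; rewrite normrN lerD//.
  apply: le_trans (ler_norm_sum _ _ _) _; apply: ler_sum => w _.
  by rewrite normrM ler_piMr// indicE; case: (_ \in _); rewrite ?normr0 ?normr1.
- under eq_Rintegral => x _ do rewrite FE.
  rewrite Rintegral_affine_cyl_sum; apply: lt_le_trans (_ : 0 < - cost + (E - s * D)) _.
    by lra.
  rewrite lerD2l /E /D mulr_sumr -sumrB; apply: ler_sum => w _.
  rewrite mulrBl [_ * p w]mulrC [s * _ * p w]mulrC mulrCA lerD2r.
  have [->|pw0] := eqVneq (p w) 0; first by rewrite !mul0r.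
  have pw : 0 < p w by rewrite lt0r pw0 cyl_mass_ge0.
  by rewrite ler_pM2l// ler_ln ?posrE// ?addr_gt0// lerDl ltW.
Qed.

Lemma geometric_tail (r : R) m n : 0 <= r < 1 -> (m <= n)%N ->
  (1 - r) * \sum_(m <= i < n) r ^+ i <= r ^+ m.
Proof.
move=> /andP[r0 r1] mn; rewrite mulr_sumr.
under eq_bigr do rewrite mulrBl mul1r -exprS -opprB.
by rewrite sumrN telescope_sumr// opprB gerBl exprn_ge0.
Qed.

Lemma upper_bound (s : R) : (conv_exponent nu < s%:E)%E ->
  (relative_exponent nu mu < s%:E)%E ->
  hausdorff_measure (cyl_dist nu) s (generic_points mu) = 0%E.
Proof.
move=> as_ bs; have [s0 _] := letter_sum_bounded as_.
have [theta [th qth]] := qb_decay qb.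
have [k [g [F [[k0 g0] sum_g gF bF I0]]]] := block_potential as_ bs.
pose f (x : shift_space) := F (word x k).
have kR : 0 < k%:R :> R by rewrite ltr0n.
(* Half the mean leaves room for the error in the limit, which gives linear growth from some time
   on. *)
set I := \int[mu]_x _ in I0; pose c := I / 2; have c0 : 0 < c by rewrite divr_gt0.
have growth x : generic_points mu x -> exists n0, forall n, (n0 <= n)%N ->
    c * n%:R <= birkhoff_sum f n x.
  move=> /(_ f (@continuous_word k F) bF) /cvgrPdist_le /= /(_ c c0)[n0 _ Hn0].
  exists n0.+1 => n n0n; have := Hn0 n (ltnW n0n); rewrite ler_norml => /andP[_ Hn].
  have nR : 0 < n%:R :> R by rewrite ltr0n (leq_trans _ n0n).
  have : c <= n%:R^-1 * birkhoff_sum f n x by move: Hn; rewrite -/I /c; lra.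
  by rewrite ler_pdivlMl// mulrC.
have [T HT] := words_sum_bounded as_ k.
have T0 : 0 <= T.
  by apply: le_trans (HT 0%N 0%N _); rewrite ?sumr_ge0// => *; exact: powR_ge0.
pose r := expR (- (c / k%:R)).
have r0 : 0 <= r by exact: expR_ge0.
have r1 : r < 1 by rewrite -expR0 ltr_expR oppr_lt0 divr_gt0.
pose W u := q (take (size u %% k) u) `^ s *
  (expR (- (c * (size u %/ k)%:R)) * block_prod k g (size u %/ k) (drop (size u %% k) u)).
apply: (hausdorff_measure_zero th qth s0) => e n0 e0.
(* The values of [W] on words of length [i] will total at most [T * expR c * r ^+ i]; from [n1] on
   the geometric tail is at most [e]. *)
have [n1 n01 Hn1] : exists2 n1, (n0 <= n1)%N & T * expR c * r ^+ n1 <= e * (1 - r).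
  have : T * expR c * r ^+ n @[n --> \oo] --> T * expR c * 0.
    apply: cvgM; first exact: cvg_cst.
    by apply: cvg_expr; rewrite ger0_norm.
  rewrite mulr0 => /cvgrPdist_le/(_ (e * (1 - r)))[|n1 _ Hn1].
    by rewrite mulr_gt0// subr_gt0.
  exists (maxn n0 n1); first exact: leq_maxl.
  have := Hn1 (maxn n0 n1) (leq_maxr _ _).
  by rewrite /= sub0r normrN => /(le_trans (ler_norm _)).
exists (fun u => (n1 <= size u)%N && (q u `^ s <= W u)); split.
- by move=> u /andP[n1u _]; exact: leq_trans n1u.
- move=> x /growth[nx Hx]; pose m := maxn nx n1.
  have mk t : (t <= m)%N -> (t <= m * k)%N by move=> /leq_trans; apply; rewrite leq_pmulr.
  have := Hx (m * k)%N (mk _ (leq_maxl _ _)).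
  rewrite /birkhoff_sum sum_residues natrM => Hsum.
  (* Pigeonhole: some residue class carries at least the average of the total growth. *)
  have [j Hj] : exists j : 'I_k, c * m%:R <= \sum_(i < m) f (iter (j + i * k) shift x).
    apply: contrapT => /forallNP Hj; move: Hsum; apply/negP; rewrite -ltNge.
    apply: (@lt_le_trans _ _ (\sum_(j < k) c * m%:R)).
      apply: ltr_sum; first by apply/hasP; exists (Ordinal k0); rewrite ?mem_index_enum.
      by move=> j _; rewrite ltNge; apply/negP/Hj.
    by rewrite sumr_const card_ord -[_ *+ k]mulr_natr mulrA.
  exists (j + m * k)%N; rewrite size_word /W size_word.
  have jm : ((j + m * k) %/ k = m)%N by rewrite addnC divnMDl// divn_small ?addn0.
  have jk : ((j + m * k) %% k = j)%N by rewrite addnC modnMDl modn_small.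
  rewrite jm jk (leq_trans (mk _ (leq_maxr _ _)) (leq_addl _ _))/=.
  rewrite take_word ?leq_addr// word_add drop_size_cat ?size_word//.
  apply: le_trans (prefix_bound (f := f) m _ _ (ltW s0) g0 (fun z => gF z)) _.
  rewrite ler_wpM2l ?powR_ge0// ler_wpM2r ?block_prod_ge0// ler_expR lerN2.
  apply: le_trans Hj _; rewrite le_eqVlt; apply/orP; left; apply/eqP.
  by apply: eq_bigr => i _; rewrite addnC iterD.
- move=> l ul /allP Gl.
  (* A finite family only involves bounded lengths and a finite alphabet, so its sum is dominated by
     full sums over [words N i]. *)
  pose L := (\max_(u <- l) (size u).+1 + n1)%N; pose N := \max_(u <- l) \max_(a <- u) a.+1.
  have W0 u : 0 <= W u.
    by rewrite /W !mulr_ge0 ?powR_ge0 ?expR_ge0 ?block_prod_ge0.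
  apply: (@le_trans _ _ (\sum_(u <- l) W u)).
    by rewrite big_seq [leRHS]big_seq; apply: ler_sum => u /Gl/andP[].
  apply: (@le_trans _ _ (\sum_(u <- flatten [seq words N i | i <- index_iota n1 L]) W u)).
    apply: leq_sum_subset => // u ulin; apply/flatten_mapP; exists (size u).
      rewrite mem_index_iota; have /andP[-> _] := Gl u ulin; rewrite /= /L.
      apply: leq_trans (leq_addr _ _).
      exact: (@leq_bigmax_seq _ _ xpredT (fun u => (size u).+1)).
    apply: words_wide.
    exact: (@leq_bigmax_seq _ _ xpredT (fun u => \max_(a <- u) a.+1)).
  rewrite big_flatten big_map.
  apply: (@le_trans _ _ (\sum_(n1 <= i < L) T * expR c * r ^+ i)).
    apply: ler_sum => i _.
    (* The last incomplete block costs at most [expR c]. *)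
    have Ei : expR (- (c * (i %/ k)%:R)) <= expR c * r ^+ i.
      rewrite /r -expRM_natl -expRD ler_expR.
      have : i%:R <= ((i %/ k)%:R + 1) * k%:R :> R.
        by rewrite natr1 -natrM ler_nat ltnW// ltn_ceil.
      rewrite -ler_pdivrMr// => Hi; have := ler_wpM2l (ltW c0) Hi.
      rewrite (_ : i%:R * - (c / k%:R) = - (c * (i%:R / k%:R))); last by ring.
      by lra.
    rewrite {1}(divn_eq i k) addnC sum_words_add.
    apply: (@le_trans _ _ (T * expR (- (c * (i %/ k)%:R)))); last first.
      by rewrite -mulrA ler_wpM2l.
    apply: (@le_trans _ _ (\sum_(u <- words N (i %% k)) q u `^ s * expR (- (c * (i %/ k)%:R)))).
      rewrite big_seq [leRHS]big_seq; apply: ler_sum => u /size_mem_words su.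
      apply: (@le_trans _ _ (\sum_(v <- words N (i %/ k * k)%N)
        q u `^ s * expR (- (c * (i %/ k)%:R)) * block_prod k g (i %/ k) v)).
        rewrite big_seq [leRHS]big_seq; apply: ler_sum => v /size_mem_words sv.
        rewrite /W size_cat su sv addnC -divn_eq.
        by rewrite (take_size_cat _ su) (drop_size_cat _ su) mulrA.
      rewrite -mulr_sumr sum_block_prod ler_piMr//.
        by rewrite mulr_ge0 ?powR_ge0 ?expR_ge0.
      by apply: exprn_ile1; [rewrite sumr_ge0|exact: sum_g].
    rewrite -mulr_suml ler_wpM2r ?expR_ge0//; apply: HT.
    by rewrite ltnW// ltn_mod.
  rewrite -mulr_sumr -(@ler_pM2r _ (1 - r)) ?subr_gt0//; apply: le_trans Hn1.
  rewrite -[_ * (1 - r)]mulrA; apply: ler_wpM2l; first by rewrite mulr_ge0// expR_ge0.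
  by rewrite mulrC geometric_tail ?r0 ?leq_addl.
Qed.

End Upper.

(** * Lower bound *)

Section Concatenation.
Variables (R : realType) (mu nu : probability borel_shift_space R) (K s : R).
Hypothesis qb : quasi_bernoulli nu K.
Hypothesis s0 : 0 < s.
Local Notation p := (cyl_mass mu).
Local Notation q := (cyl_mass nu).
Local Notation cnt v n x := (birkhoff_sum (\1_(cylinder v) : shift_space -> R) n x).

Variables (len : nat -> nat) (blocks : nat -> seq (seq nat)) (wt : nat -> seq nat -> R).
Variable C : R.
Hypothesis len_gt0 : forall t, (0 < len t)%N.
Hypothesis blocks_uniq : forall t, uniq (blocks t).
Hypothesis size_blocks : forall t w, w \in blocks t -> size w = len t.
Hypothesis wt_ge0 : forall t w, 0 <= wt t w.
Hypothesis wt_sum : forall t, \sum_(w <- blocks t) wt t w = 1.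
(** The factors 1/2 accumulate to [2^-1 ^+ t] over [t] blocks; [block_lower] spends this gain on
    prefixes that end inside a block. *)
Hypothesis wt_le : forall t w, w \in blocks t -> wt t w <= 2^-1 * (q w / K) `^ s.
Hypothesis block_lower : forall t w, w \in blocks t -> 2^-1 ^+ t <= C * (q w / K) `^ s.
Hypothesis blocks_typical : forall v (e : R), 0 < e -> exists r0, forall r w x, (r0 <= r)%N ->
  w \in blocks r -> cylinder w x ->
  `|cnt v (len r) x - (len r)%:R * p v| <= e * (len r)%:R.
Hypothesis len_slow : forall e : R, 0 < e -> exists t0, forall t, (t0 <= t)%N ->
  (len t)%:R <= e * t%:R.

Let K1 : 1 <= K. Proof. by case: qb. Qed.
Let K0 : 0 < K. Proof. exact: lt_le_trans K1. Qed.
Let q0 w : 0 < q w. Proof. by case: qb. Qed.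
Let qL u v : q u * q v <= K * q (u ++ v). Proof. by case: qb. Qed.

Definition pos t := (\sum_(r < t) len r)%N.

Lemma posS t : pos t.+1 = (pos t + len t)%N.
Proof. by rewrite /pos big_ord_recr. Qed.

Lemma pos_ge t : (t <= pos t)%N.
Proof. by elim: t => // t IH; rewrite posS -addn1 leq_add. Qed.

Lemma pos_mono t t' : (t <= t')%N -> (pos t <= pos t')%N.
Proof.
move=> /subnKC <-; elim: (t' - t)%N => [|d IH]; first by rewrite addn0.
by rewrite addnS posS (leq_trans IH)// leq_addr.
Qed.

Lemma pos_bracket n : exists t, (pos t <= n < pos t.+1)%N.
Proof.
elim: n => [|n [t /andP[tn nt]]].
  by exists 0%N; rewrite posS /pos big_ord0 leqnn add0n len_gt0.
case: (ltnP n.+1 (pos t.+1)) => nt'; first by exists t; rewrite nt' (leq_trans tn).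
by exists t.+1; rewrite nt' posS (leq_ltn_trans nt)// -addn1 leq_add2l.
Qed.

(* The mass of the cylinder [u], of length [pos t], for the product of the weights [wt]; no
   measure with these masses is ever constructed. *)
Fixpoint mass t (u : seq nat) : R :=
  if t is t'.+1 then
    let w := drop (pos t') u in
    mass t' (take (pos t') u) * (if w \in blocks t' then wt t' w else 0)
  else 1.

Lemma mass_ge0 t u : 0 <= mass t u.
Proof. by elim: t u => //= t IH u; rewrite mulr_ge0//; case: ifP. Qed.

Lemma mass_cat t u w : size u = pos t -> w \in blocks t ->
  mass t.+1 (u ++ w) = mass t u * wt t w.
Proof. by move=> su wt_; rewrite /= (take_size_cat _ su) (drop_size_cat _ su) wt_. Qed.

Lemma powR_qL u v : q u `^ s * (q v / K) `^ s <= q (u ++ v) `^ s.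
Proof.
rewrite -powRM ?divr_ge0 ?(ltW (q0 _)) ?(ltW K0)//.
apply: ge0_ler_powR; first exact: ltW.
- by rewrite nnegrE mulr_ge0 ?divr_ge0 ?(ltW (q0 _)) ?(ltW K0).
- by rewrite nnegrE (ltW (q0 _)).
by rewrite mulrA ler_pdivrMr// [_ * K]mulrC.
Qed.

(** The division by [K] in [wt_le] absorbs the constant of quasi-multiplicativity at each
    concatenation, and one factor 1/2 is kept per block. *)
Lemma mass_le t u : size u = pos t -> mass t u <= 2^-1 ^+ t * q u `^ s.
Proof.
elim: t u => [u|t IH u] su.
  move: su; rewrite /pos big_ord0 => /size0nil ->.
  by rewrite /= expr0 mul1r cyl_mass_nil powR1.
have su1 : size (take (pos t) u) = pos t by rewrite size_takel// su posS leq_addr.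
rewrite /=; case: ifP => wt_; last by rewrite mulr0 mulr_ge0 ?powR_ge0 ?exprn_ge0.
rewrite -{3}(cat_take_drop (pos t) u) exprSr -mulrA.
apply: le_trans (ler_pM (mass_ge0 _ _) (wt_ge0 _ _) (IH _ su1) (wt_le wt_)) _.
rewrite mulrACA -mulrA ler_wpM2l ?exprn_ge0// ler_wpM2l//.
exact: powR_qL.
Qed.

Definition concatenations : set shift_space := [set x | forall t, 0 < mass t (word x (pos t))].

Lemma concatenation_block x t : concatenations x ->
  word (iter (pos t) shift x) (len t) \in blocks t.
Proof.
move=> /(_ t.+1) /=; rewrite posS word_add drop_size_cat ?size_word//.
by case: ifP => // _; rewrite mulr0 ltxx.
Qed.

Lemma C_ge0 : 0 <= C.
Proof.
have [b0 [w wb]] : exists b, exists w, w \in blocks b.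
  exists 0%N; case E : (blocks 0) (wt_sum 0) => [|w l].
    by rewrite big_nil => /esym/eqP; rewrite oner_eq0.
  by exists w; rewrite mem_head.
have := block_lower wb; rewrite leNgt => /negP H; rewrite leNgt; apply/negP => C0.
apply: H; apply: (@lt_le_trans _ _ 0); last by rewrite exprn_ge0.
by rewrite nmulr_rlt0// powR_gt0// divr_gt0.
Qed.

(** [block_lower] trades [2^-1 ^+ t] for the mass of the whole next block, so the bound reaches the
    prefix of length [pos t.+1], hence every shorter one. *)
Lemma mass_prefix_le x t n : concatenations x -> (pos t <= n < pos t.+1)%N ->
  mass t (word x (pos t)) <= C * q (word x n) `^ s.
Proof.
move=> Ex /andP[tn nt]; have wb := concatenation_block t Ex.
apply: le_trans (mass_le (size_word _ _)) _.
set w := word (iter (pos t) shift x) (len t) in wb.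
apply: (@le_trans _ _ (C * (q w / K) `^ s * q (word x (pos t)) `^ s)).
  by rewrite ler_wpM2r ?powR_ge0// block_lower.
rewrite -mulrA ler_wpM2l ?C_ge0// mulrC; apply: le_trans (powR_qL _ _) _.
rewrite /w -word_add -posS; apply: ge0_ler_powR; rewrite ?nnegrE ?cyl_mass_ge0 ?(ltW s0)//.
by rewrite -(subnKC (ltnW nt)) word_add cyl_mass_cat_le.
Qed.

Lemma cnt_bounds v n x : 0 <= cnt v n x <= n%:R.
Proof.
apply/andP; split; first by apply: sumr_ge0 => i _; rewrite indicE.
rewrite -[leRHS]mulr1 mulr_natl -[in leRHS](subn0 n) -sumr_const_nat.
by apply: ler_sum => i _; rewrite indicE lern1 leq_b1.
Qed.

Lemma cnt_trivial v n x : `|cnt v n x - n%:R * p v| <= n%:R.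
Proof.
have /andP[c0 cn] := cnt_bounds v n x.
have p0 := cyl_mass_ge0 mu v; have p1 := cyl_mass_le1 mu v.
have h1 : 0 <= n%:R * p v by rewrite mulr_ge0.
have h2 : n%:R * p v <= n%:R by rewrite ler_piMr.
by rewrite ler_norml; apply/andP; split; lra.
Qed.

Lemma cnt_near_add v m n x (a b : R) :
  `|cnt v m x - m%:R * p v| <= a -> `|cnt v n (iter m shift x) - n%:R * p v| <= b ->
  `|cnt v (m + n)%N x - (m + n)%:R * p v| <= a + b.
Proof.
move=> ha hb; rewrite birkhoff_sum_add natrD.
rewrite (_ : _ - _ = (cnt v m x - m%:R * p v) + (cnt v n (iter m shift x) - n%:R * p v)).
  by apply: le_trans (ler_normD _ _) _; exact: lerD.
by ring.
Qed.

(** Three errors are at most a third each: the blocks before [r0], a fixed amount; the typical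
    blocks after them; and the unfinished last block, short by [len_slow]. *)
Lemma concatenation_generic x : concatenations x -> generic_points mu x.
Proof.
move=> Ex; apply: generic_of_frequencies => v e e0; have e3 : 0 < e / 3 by lra.
have [r0 Hr0] := blocks_typical v e3; have [t0 Ht0] := len_slow e3.
have at_pos t : `|cnt v (pos t) x - (pos t)%:R * p v| <= (pos r0)%:R + e / 3 * (pos t)%:R.
  elim: t => [|t IH].
    by apply: le_trans (cnt_trivial _ _ _) _; rewrite /pos big_ord0 mulr0 addr0 ler0n.
  have [tr|rt] := ltnP t r0.
    apply: le_trans (cnt_trivial _ _ _) _.
    by apply: ler_wpDr; [rewrite mulr_ge0// ltW|rewrite ler_nat pos_mono].
  rewrite [in leLHS]posS; have H := Hr0 t _ (iter (pos t) shift x) rt (concatenation_block t Ex).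
  rewrite /cylinder/= size_word in H.
  apply: le_trans (cnt_near_add IH (H erefl)) _.
  by rewrite posS natrD mulrDr addrA.
exists (maxn (pos t0) (Num.truncn ((pos r0)%:R / (e / 3))).+1) => n.
rewrite geq_max => /andP[t0n r0n]; have [t /andP[tn nt]] := pos_bracket n.
have t0t : (t0 <= t)%N.
  rewrite leqNgt; apply/negP => tt0; move: nt; rewrite ltnNge => /negP; apply.
  exact: leq_trans (pos_mono tt0) t0n.
rewrite -{1 2}(subnKC tn).
apply: le_trans (cnt_near_add (at_pos t) (cnt_trivial _ (n - pos t) _)) _.
have h1 : (n - pos t)%:R <= e / 3 * n%:R :> R.
  apply: (@le_trans _ _ (len t)%:R); first by rewrite ler_nat leq_subLR -posS ltnW.
  apply: le_trans (Ht0 t t0t) _; rewrite ler_wpM2l ?(ltW e3)// ler_nat.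
  exact: leq_trans (pos_ge t) tn.
have h2 : (pos r0)%:R <= e / 3 * n%:R :> R.
  rewrite mulrC -ler_pdivrMr//; apply: ltW; apply: lt_le_trans (truncnS_gt _) _.
  by rewrite ler_nat.
have h3 : e / 3 * (pos t)%:R <= e / 3 * n%:R by rewrite ler_wpM2l ?(ltW e3)// ler_nat.
by lra.
Qed.

Lemma mass_small (dl : R) : 0 < dl -> exists t, forall u, size u = pos t -> mass t u <= dl.
Proof.
move=> dl0; have : (2^-1 : R) ^+ t @[t --> \oo] --> 0 by apply: cvg_expr; rewrite ger0_norm; lra.
move=> /cvgrPdist_le/(_ dl dl0)[t _ /(_ t (leqnn t))].
rewrite /= sub0r normrN => /(le_trans (ler_norm _)) Ht; exists t => u su.
apply: le_trans (mass_le su) (le_trans _ Ht).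
rewrite ler_piMr ?exprn_ge0//.
by rewrite -(powRr0 (q u)) ger_powR ?q0 ?cyl_mass_le1// ltW.
Qed.

(* A set meeting the concatenations in two points at least is contained in a cylinder of mass
   comparable to its diameter, after truncating the common prefix to a whole number of
   blocks; the other sets lie in cylinders of arbitrarily small mass. *)
Lemma cover_word (U : set shift_space) (dl : R) : 0 < dl -> exists t c,
  [/\ size c = pos t, forall x, U x -> concatenations x -> word x (pos t) = c
  & ((mass t c)%:E <= C%:E * poweR (diam (cyl_dist nu) U) s + dl%:E)%E].
Proof.
move=> dl0; pose V := U `&` concatenations.
have rhs_ge0 : (0 <= C%:E * poweR (diam (cyl_dist nu) U) s)%E.
  by rewrite mule_ge0 ?poweR_ge0// lee_fin C_ge0.
have [single|] := pselect (forall y z i, V y -> V z -> y i = z i).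
  have [t Ht] := mass_small dl0.
  have [y Hy] : exists y, forall x i, V x -> x i = y i.
    have [[y Vy]|noV] := pselect (exists y, V y).
      by exists y => x i Vx; apply: single.
    by exists (pad [::]) => x i Vx; case: noV; exists x.
  exists t, (word y (pos t)); split; first exact: size_word.
    by move=> x Ux Ex; apply/eq_word => i _; apply: Hy.
  apply: (@le_trans _ _ dl%:E); first by rewrite lee_fin Ht ?size_word.
  by rewrite leeDr.
(* The least index [n] at which two points of [V] differ: the points of [V] share a prefix of length
   [n], whose mass is at most the diameter. *)
move=> multi; have ex_n : exists n, `[< exists y z, [/\ V y, V z & y n != z n] >].
  apply: contrapT => /forallNP H; apply: multi => y z i Vy Vz; apply/eqP.
  by apply: contrapT => /negP yz; apply: (H i); apply/asboolP; exists y, z.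
have [n /asboolP[y [z [Vy Vz yzn]]] nmin] := ex_minnP ex_n.
have agree x x' : V x -> V x' -> word x n = word x' n.
  move=> Vx Vx'; apply/eq_word => i i_n; apply/eqP; apply: contrapT => /negP xx'.
  have := nmin i; rewrite leqNgt i_n => /(_ _)/negP; apply => //.
  by apply/asboolP; exists x, x'.
have [t /andP[tn nt]] := pos_bracket n.
exists t, (word y (pos t)); split; first exact: size_word.
  by move=> x Ux Ex; rewrite -(take_word x tn) (agree x y)// take_word.
apply: (@le_trans _ _ (C%:E * poweR (diam (cyl_dist nu) U) s)%E); last first.
  by rewrite leeDl// lee_fin ltW.
have dyz : cyl_dist nu y z = q (word y n).
  rewrite /cyl_dist; case: pselect => [yz|]; last by case; exists n.
  case: ex_minnP => k yzk kmin; congr (q (word y _)); apply/eqP.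
  rewrite eqn_leq kmin//= leqNgt; apply/negP => kn; move/eqP: yzk; apply.
  by have [_ H] := eq_word y z n; apply: H kn; exact: agree.
apply: (@le_trans _ _ (C%:E * poweR (q (word y n))%:E s)%E).
  by rewrite poweR_EFin -EFinM lee_fin mass_prefix_le ?tn//; case: Vy.
apply: lee_wpmul2l; first by rewrite lee_fin C_ge0.
apply: gt0_ler_poweR.
- exact: ltW.
- by rewrite in_itv/= lee_fin cyl_mass_ge0 leey.
- by rewrite in_itv/= diam_ge0 leey.
rewrite /diam le_max; apply/orP; right; apply: ereal_sup_ubound.
by exists y, z; split; [case: Vy|case: Vz|rewrite dyz].
Qed.

(* Mass distribution principle without a measure: extend the word block by block, so that
   the forbidden words below it always have a smaller total mass than the word itself. *)
Lemma avoiding_concatenation (lev : nat -> nat) (c : nat -> seq nat) :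
  (forall i, size (c i) = pos (lev i)) ->
  (\sum_(0 <= i <oo) (mass (lev i) (c i))%:E < 1)%E ->
  exists2 x, concatenations x & forall i, word x (pos (lev i)) <> c i.
Proof.
move=> sc mc; pose below t u i := (t <= lev i)%N && (take (pos t) (c i) == u).
pose load t u := (\sum_(0 <= i <oo) (if below t u i then mass (lev i) (c i) else 0)%:E)%E.
have load_ge0 t u i : (0 <= (if below t u i then mass (lev i) (c i) else 0)%:E)%E.
  by rewrite lee_fin; case: ifP => // _; exact: mass_ge0.
pose inv t u := size u = pos t /\ (load t u < (mass t u)%:E)%E.
have step t u : inv t u -> exists w, w \in blocks t /\ inv t.+1 (u ++ w).
  (* Otherwise every child violates the invariant. Summing over the blocks gives a contradiction, as
     the masses of the children add up to that of [u] and each forbidden word lies below at most one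
     child. *)
  move=> [su lu]; apply: contrapT => /forallNP H; move: lu; apply/negP; rewrite -leNgt.
  have mS : (mass t u)%:E = (\sum_(w <- blocks t) (mass t.+1 (u ++ w))%:E)%E.
    rewrite sumEFin big_seq (eq_bigr (fun w => mass t u * wt t w)).
      by rewrite -big_seq -mulr_sumr wt_sum mulr1.
    by move=> w wb; rewrite mass_cat.
  rewrite mS; apply: (@le_trans _ _ (\sum_(w <- blocks t) load t.+1 (u ++ w))%E).
    rewrite big_seq [leRHS]big_seq; apply: lee_sum => w wb; rewrite leNgt; apply/negP => lw.
    apply: (H w); split => //; split => //.
    by rewrite size_cat su posS (size_blocks wb).
  rewrite -nneseries_sum//; apply: lee_nneseries => [i _ _|i _].
    by apply: sume_ge0 => w _.
  rewrite sumEFin lee_fin; have [[w wb bw]|none] :=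
      pselect (exists2 w, w \in blocks t & below t.+1 (u ++ w) i).
    rewrite (bigD1_seq w)//= bw big1 ?addr0; last first.
      move=> w' w'w; case: ifP => // /andP[_ /eqP cw']; case/andP: bw => _ /eqP cw.
      by move: cw'; rewrite cw => /eqP; rewrite eqseq_cat// eqxx/= eq_sym (negbTE w'w).
    case/andP: bw => ti /eqP cw; rewrite /below (ltnW ti)/=.
    rewrite -(take_takel _ (pos_mono (leqnSn t))) cw (take_size_cat _ su) eqxx.
    by [].
  rewrite big_seq big1 => [|w wb]; first by have := load_ge0 t u i; rewrite lee_fin.
  by case: ifP => // bw; case: none; exists w.
pose nxt t u := xget [::] [set w | w \in blocks t /\ inv t.+1 (u ++ w)].
pose us := fix us t := if t is t'.+1 then us t' ++ nxt t' (us t') else [::].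
have us_inv t : inv t (us t).
  elim: t => [|t /step H]; last by have [_] := xgetPex [::] H.
  split; first by rewrite /pos big_ord0.
  apply: le_lt_trans mc; apply: lee_nneseries => [i _ _|i _]; first exact: load_ge0.
  by rewrite lee_fin; case: ifP => // _; exact: mass_ge0.
have us_take t d : take (pos t) (us (t + d)%N) = us t.
  elim: d => [|d IH]; first by rewrite addn0 take_oversize// (us_inv t).1.
  by rewrite addnS /= takel_cat ?IH// (us_inv _).1 pos_mono// leq_addr.
(* By [pos_ge], [us i.+1] is long enough to have a letter of index [i]. *)
pose x : shift_space := fun i => nth 0%N (us i.+1) i.
have x_us t : word x (pos t) = us t.
  apply: (@eq_from_nth _ 0%N) => [|i]; rewrite size_word ?(us_inv t).1// => it.
  rewrite nth_word// /x -(us_take i.+1 t) nth_take ?pos_ge//.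
  by rewrite -(us_take t i.+1) nth_take// addnC.
exists x => [t|i xc].
  rewrite x_us -lte_fin; apply: le_lt_trans (us_inv t).2.
  by apply: nneseries_ge0 => i _ _; exact: load_ge0.
(* At level [lev i] the word [c i] would count in its own load, which would then be at least its
   mass. *)
have := (us_inv (lev i)).2; rewrite -x_us xc; apply/negP; rewrite -leNgt.
rewrite /load; apply: (@le_trans _ _
  (\sum_(0 <= j < i.+1) (if below (lev i) (c i) j then mass (lev j) (c j) else 0)%:E)%E).
  rewrite big_nat_recr//= {2}/below leqnn/= take_oversize ?sc// eqxx.
  by rewrite leeDr// sume_ge0.
by apply: nneseries_lim_ge.
Qed.

Lemma concatenations_hausdorff :
  hausdorff_measure (cyl_dist nu) s (generic_points mu) <> 0%E.
Proof.
(* With this [eta] the diameters contribute at most 1/4, and the [dl i] below sum to 1/2, so the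
   forbidden mass stays below 1. *)
move=> H0; pose eta : R := (4 * (C + 1))^-1.
have C0 := C_ge0; have eta0 : 0 < eta by rewrite invr_gt0; lra.
have : (hausdorff_premeasure (cyl_dist nu) s 1 (generic_points mu) < eta%:E)%E.
  apply: (@le_lt_trans _ _ 0%E); last by rewrite lte_fin.
  by rewrite -H0; apply: ereal_sup_ubound; exists 1 => /=.
move=> /ereal_inf_lt[_ [U [cov _] <-]] Ueta.
pose dl i : R := 2^-1 / (2 ^ i.+1)%:R.
have dl0 i : 0 < dl i by rewrite divr_gt0// ltr0n expn_gt0.
have /choice[tc Htc] : forall i, exists tc : nat * seq nat,
    [/\ size tc.2 = pos tc.1,
        forall x, U i x -> concatenations x -> word x (pos tc.1) = tc.2
      & ((mass tc.1 tc.2)%:E <= C%:E * poweR (diam (cyl_dist nu) (U i)) s + (dl i)%:E)%E].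
  by move=> i; have [t [c H]] := cover_word (U i) (dl0 i); exists (t, c).
have [||x Ex Hx] := @avoiding_concatenation (fun i => (tc i).1) (fun i => (tc i).2).
- by move=> i; have [] := Htc i.
- apply: (@le_lt_trans _ _ (\sum_(0 <= i <oo)
    (C%:E * poweR (diam (cyl_dist nu) (U i)) s + (dl i)%:E))%E).
    apply: lee_nneseries => [i _ _|i _]; first by rewrite lee_fin mass_ge0.
    by have [] := Htc i.
  have D0 i : (0 <= C%:E * poweR (diam (cyl_dist nu) (U i)) s)%E.
    by rewrite mule_ge0 ?poweR_ge0// lee_fin.
  apply: le_lt_trans (epsilon_trick _ D0 _) _ => //.
  rewrite nneseriesZl; last by move=> i _; exact: poweR_ge0.
  apply: (@le_lt_trans _ _ (C%:E * eta%:E + 2^-1%:E)%E).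
    by rewrite leeD2r// lee_wpmul2l ?lee_fin// ltW.
  rewrite -EFinM -EFinD lte_fin; suff : C * eta <= 4^-1 by lra.
  by rewrite /eta ler_pdivrMr; lra.
have [i _ Ux] := cov x (concatenation_generic Ex).
by apply: (Hx i); have [_ + _] := Htc i; apply.
Qed.

End Concatenation.

(** Takes the largest [i <= t] with [B i <= t], and 0 if there is none: stage [i] waits until time
    [B i], yet every stage is eventually passed. *)
Lemma slow_index (B : nat -> nat) : exists sigma : nat -> nat,
  (forall t, sigma t = 0%N \/ (B (sigma t) <= t)%N) /\
  (forall i, exists t0, forall t, (t0 <= t)%N -> (i <= sigma t)%N).
Proof.
exists (fun t => \max_(i < t.+1 | (B i <= t)%N) i); split => [t|i].
  apply: (big_ind (fun n => n = 0%N \/ (B n <= t)%N)); first by left.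
    by move=> m n Hm Hn; case: (leqP m n).
  by move=> i Bi; right.
exists (maxn i (B i)) => t; rewrite geq_max => /andP[it Bit].
have it' : (i < t.+1)%N by [].
exact: (@leq_bigmax_cond _ (fun j : 'I_t.+1 => B j <= t)%N (fun j => val j) (Ordinal it')).
Qed.

Lemma seq_lower_bound (R : realType) (T : eqType) (F : T -> R) (l : seq T) :
  (forall w, 0 < F w) -> exists2 c, 0 < c & forall w, w \in l -> c <= F w.
Proof.
move=> F0; elim: l => [|v l [c c0 Hc]]; first by exists 1.
exists (Num.min c (F v)); first by rewrite lt_min c0 F0.
move=> w; rewrite inE => /predU1P[->|/Hc cw]; first by rewrite ge_min lexx orbT.
by rewrite ge_min cw.
Qed.

(** * Scheduling of the block sets *)

Section Stages.
Variables (R : realType) (mu nu : probability borel_shift_space R) (K s : R).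
Hypothesis qb : quasi_bernoulli nu K.
Hypothesis s0 : 0 < s.
Local Notation p := (cyl_mass mu).
Local Notation q := (cyl_mass nu).
Local Notation cnt v n x := (birkhoff_sum (\1_(cylinder v) : shift_space -> R) n x).

Let K1 : 1 <= K. Proof. by case: qb. Qed.
Let K0 : 0 < K. Proof. exact: lt_le_trans K1. Qed.
Let q0 w : 0 < q w. Proof. by case: qb. Qed.

(** Occurrences of [v] may overlap the end of [w], hence the quantification over all points of its
    cylinder. *)
Definition typical (e : R) (V : seq (seq nat)) (n : nat) (w : seq nat) :=
  forall v x, v \in V -> cylinder w x -> `|cnt v n x - n%:R * p v| <= e * n%:R.

(** One block set with its probability weight; the last clause is the bound required of the weights
    in the concatenation argument. *)
Definition stage (e : R) (V : seq (seq nat)) (n : nat) (W : seq (seq nat))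
    (P : seq nat -> R) :=
  [/\ (0 < n)%N /\ uniq W, forall w, w \in W -> size w = n /\ typical e V n w,
    forall w, 0 <= P w, \sum_(w <- W) P w = 1
  & forall w, w \in W -> P w <= 2^-1 * (q w / K) `^ s].

(** Stage [i] has precision [1 / (i + 1)] for the words of code below [i]. Delaying it long enough
    makes its blocks short compared with the time and their masses large compared with
    [2^-1 ^+ t]. *)
Lemma hausdorff_nonzero_of_stages :
  (forall e V, 0 < e -> exists n W P, stage e V n W P) ->
  hausdorff_measure (cyl_dist nu) s (generic_points mu) <> 0%E.
Proof.
move=> Hst; pose V i : seq (seq nat) := pmap pickle_inv (iota 0 i).
have mem_V i v : (pickle v < i)%N -> v \in V i.
  move=> vi; rewrite mem_pmap; apply/mapP; exists (pickle v); first by rewrite mem_iota.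
  by rewrite pickleK_inv.
have /choice[st Hst'] : forall i : nat, exists st : nat * seq (seq nat) * (seq nat -> R),
    stage i.+1%:R^-1 (V i) st.1.1 st.1.2 st.2.
  by move=> i; have [|n [W [P H]]] := Hst i.+1%:R^-1 (V i); [|exists (n, W, P)].
pose n i := (st i).1.1; pose W i := (st i).1.2; pose P i := (st i).2.
have qK0 w : 0 < (q w / K) `^ s by rewrite powR_gt0// divr_gt0.
have /choice[c Hc] : forall i, exists c, 0 < c /\ forall w, w \in W i -> c <= (q w / K) `^ s.
  by move=> i; have [c c0 H] := seq_lower_bound (W i) qK0; exists c.
have /choice[B HB] : forall i, exists B,
    (forall t, (B <= t)%N -> 2^-1 ^+ t <= c i) /\ (i * n i <= B)%N.
  move=> i; have [ci0 _] := Hc i.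
  have : (2^-1 : R) ^+ t @[t --> \oo] --> 0 by apply: cvg_expr; rewrite ger0_norm; lra.
  move=> /cvgrPdist_le/(_ _ ci0)[t0 _ Ht0].
  exists (maxn t0 (i * n i)); split; last exact: leq_maxr.
  move=> t; rewrite geq_max => /andP[/Ht0 + _].
  by rewrite /= sub0r normrN => /(le_trans (ler_norm _)).
have [sigma [sB soo]] := slow_index B.
have inv_small (e : R) : 0 < e -> exists2 i, (0 < i)%N & forall j, (i <= j)%N -> j%:R^-1 <= e.
  move=> e0; exists (Num.truncn e^-1).+1 => // j ij.
  rewrite -[e]invrK lef_pV2 ?posrE ?invr_gt0// ?ltr0n; last exact: leq_ltn_trans ij.
  by apply/ltW/(lt_le_trans (truncnS_gt _)); rewrite ler_nat.
have c00 : 0 < c 0%N by have [] := Hc 0%N.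
(* [(c 0%N)^-1] serves the times still at stage 0, where [B] gives no information; 1 serves the
   others. *)
apply: (@concatenations_hausdorff R mu nu K s qb s0 (n \o sigma) (W \o sigma) (P \o sigma)
  (1 + (c 0%N)^-1)) => /=.
- by move=> t; have [[]] := Hst' (sigma t).
- by move=> t; have [[]] := Hst' (sigma t).
- by move=> t w wW; have [_ /(_ w wW)[]] := Hst' (sigma t).
- by move=> t w; have [_ _ H _ _] := Hst' (sigma t); exact: H.
- by move=> t; have [_ _ _ H _] := Hst' (sigma t).
- by move=> t w wW; have [_ _ _ _ H] := Hst' (sigma t); exact: H.
- move=> t w wW; have [_ /(_ _ wW) cw] := Hc (sigma t).
  have qK := qK0 w; case: (sB t) => [st0|Bt].
    rewrite st0 in cw; apply: (@le_trans _ _ 1); first by apply: exprn_ile1; lra.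
    apply: (@le_trans _ _ ((c 0%N)^-1 * (q w / K) `^ s)).
      by rewrite ler_pdivlMl// mulr1.
    by rewrite ler_pM2r// lerDr.
  apply: le_trans ((HB (sigma t)).1 t Bt) _; apply: le_trans cw _.
  by rewrite ler_peMl ?(ltW qK)// lerDl invr_ge0 ltW.
- move=> v e e0; have [i i0 Hi] := inv_small e e0.
  have [r0 Hr0] := soo (maxn i (pickle v).+1); exists r0 => r w x /Hr0.
  rewrite geq_max => /andP[ir vr] wW wx; have [_ /(_ w wW)[_ tw] _ _ _] := Hst' (sigma r).
  apply: le_trans (tw v x (mem_V _ _ vr) wx) _.
  by rewrite ler_wpM2r// Hi// (leq_trans ir).
- move=> e e0; have [i i0 Hi] := inv_small e e0.
  have [t0 Ht0] := soo i; exists t0 => t /Ht0 it.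
  have st0 : (0 < sigma t)%N by exact: leq_trans i0 it.
  case: (sB t) => [st00|Bt]; first by rewrite st00 in st0.
  have := leq_trans (HB (sigma t)).2 Bt; rewrite -(ler_nat R) natrM.
  rewrite -ler_pdivlMl ?ltr0n// => /le_trans; apply.
  by rewrite ler_wpM2r// Hi.
Qed.

End Stages.

(** * Weak law of large numbers for independent blocks *)

Section BlockLaw.
Variables (R : realType) (N k : nat) (pr : seq nat -> R).
Hypothesis pr_ge0 : forall w, 0 <= pr w.
Hypothesis pr_sum : \sum_(w <- words N k) pr w = 1.

Fixpoint block_sum (f : seq nat -> R) (m : nat) (w : seq nat) : R :=
  if m is m'.+1 then f (take k w) + block_sum f m' (drop k w) else 0.
Arguments block_sum : simpl never.

Lemma block_sumS f m w : block_sum f m.+1 w = f (take k w) + block_sum f m (drop k w).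
Proof. by []. Qed.

Lemma block_sum_shift f c m w :
  block_sum (fun u => f u - c) m w = block_sum f m w - m%:R * c.
Proof.
elim: m w => [|m IH] w; first by rewrite /block_sum mul0r subrr.
by rewrite !block_sumS IH -natr1; ring.
Qed.

Let mean f := \sum_(w <- words N k) pr w * f w.
(** Expectation for [m] independent blocks of law [pr]. *)
Let expect m (F : seq nat -> R) := \sum_(w <- words N (m * k)%N) block_prod k pr m w * F w.

Lemma expectS m F : expect m.+1 F =
  \sum_(u <- words N k) pr u * expect m (fun v => F (u ++ v)).
Proof.
rewrite /expect mulSn sum_words_add; apply: eq_big_seq => u /size_mem_words su.
rewrite mulr_sumr; apply: eq_bigr => v _ /=.
by rewrite take_size_cat// drop_size_cat// mulrA.
Qed.

Lemma expect1 m : expect m (fun=> 1) = 1.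
Proof.
rewrite /expect; under eq_bigr do rewrite mulr1.
by rewrite sum_block_prod pr_sum expr1n.
Qed.

(** Peeling off the first block, the cross term vanishes by independence and centering, so variances
    add. *)
Lemma block_variance f m : mean f = 0 ->
  expect m (block_sum f m) = 0 /\
  expect m (fun w => block_sum f m w ^+ 2) = m%:R * mean (fun w => f w ^+ 2).
Proof.
move=> f0; elim: m => [|m [IH1 IH2]].
  by rewrite /expect !mul0n !big_seq1 /block_sum expr0n !mulr0 mul0r.
have cat_sum (u v : seq nat) : u \in words N k ->
    block_sum f m.+1 (u ++ v) = f u + block_sum f m v.
  by move=> /size_mem_words su; rewrite block_sumS take_size_cat// drop_size_cat.
rewrite !expectS; split.
  rewrite (eq_big_seq (fun u => pr u * f u)) => [|u uw]; first exact: f0.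
  congr (_ * _); rewrite -[RHS]addr0 -IH1 -[f u]mulr1 -(expect1 m) mulr_sumr -big_split/=.
  by apply: eq_bigr => v _; rewrite (cat_sum _ _ uw); ring.
rewrite (eq_big_seq (fun u => pr u * f u ^+ 2 + pr u * (m%:R * mean (fun w => f w ^+ 2)))).
  by rewrite big_split/= -mulr_suml pr_sum mul1r -natr1 mulrDl mul1r addrC.
move=> u uw; rewrite -mulrDr; congr (_ * _).
transitivity (expect m (fun=> 1) * f u ^+ 2 + f u * 2 * expect m (block_sum f m)
   + expect m (fun w => block_sum f m w ^+ 2)); last first.
  by rewrite expect1 IH1 IH2 mul1r mulr0 addr0.
rewrite mulr_suml mulr_sumr -!big_split/=; apply: eq_bigr => v _.
by rewrite (cat_sum _ _ uw); ring.
Qed.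

Lemma block_chebyshev f m (e : R) : 0 < e -> (0 < m)%N -> mean f = 0 ->
  \sum_(w <- words N (m * k)%N | ~~ (`|block_sum f m w| <= e * m%:R)) block_prod k pr m w
  <= mean (fun w => f w ^+ 2) / e ^+ 2 / m%:R.
Proof.
move=> e0 m0 /(block_variance m)[_ var]; have mR : 0 < m%:R :> R by rewrite ltr0n.
rewrite ler_pdivlMr// ler_pdivlMr ?exprn_gt0// -(ler_pM2r mR).
rewrite [leRHS]mulrC -var -!mulrA mulr_suml.
rewrite [leRHS](bigID (fun w => ~~ (`|block_sum f m w| <= e * m%:R)))/=.
rewrite -[leLHS]addr0 lerD//.
  apply: ler_sum => w; rewrite -ltNge => /ltW ew; rewrite ler_wpM2l ?block_prod_ge0//.
  rewrite -[leRHS]real_normK ?num_real//.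
  rewrite (_ : _ * _ = (e * m%:R) ^+ 2); last by ring.
  by rewrite ler_sqr ?nnegrE// mulr_ge0// ltW.
by apply: sumr_ge0 => w _; rewrite mulr_ge0 ?block_prod_ge0// exprn_even_ge0.
Qed.

(** Chebyshev's inequality for each centered function, then a union bound that halves [dl] at each
    function. *)
Lemma block_law (fs : seq (seq nat -> R)) (e dl : R) : 0 < e -> 0 < dl ->
  exists m0, forall m, (m0 <= m)%N ->
  \sum_(w <- words N (m * k)%N |
     ~~ all (fun f => `|block_sum f m w - m%:R * mean f| <= e * m%:R) fs)
     block_prod k pr m w <= dl.
Proof.
move=> e0; elim: fs dl => [|f fs IH] dl dl0.
  by exists 0%N => m _; rewrite big_pred0 // ltW.
have dl2 : 0 < dl / 2 by lra.
have [m1 H1] := IH _ dl2; pose g u := f u - mean f.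
have g0 : mean g = 0.
  rewrite /mean /g; under eq_bigr do rewrite mulrBr.
  by rewrite sumrB -mulr_suml pr_sum mul1r subrr.
pose var := mean (fun w => g w ^+ 2) / e ^+ 2.
have [m2 H2] := natural_large var dl2.
exists (maxn m1 m2.+1) => m; rewrite geq_max => /andP[/H1 {}H1 m2m].
have mR : 0 < m%:R :> R by rewrite ltr0n (leq_trans _ m2m).
have cheb := block_chebyshev e0 (leq_trans (ltn0Sn _) m2m) g0.
have {}H2 := H2 m (ltnW m2m).
apply: (@le_trans _ _ (dl / 2 + dl / 2)); last by lra.
apply: le_trans (lerD (le_trans cheb _) H1); last first.
  by rewrite ler_pdivrMr// [leRHS]mulrC ltW.
rewrite [leLHS]big_mkcond [X in _ <= X + _]big_mkcond [X in _ <= _ + X]big_mkcond -big_split/=.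
apply: ler_sum => w _; rewrite block_sum_shift negb_and.
have := block_prod_ge0 k m w pr_ge0.
by case: (`|_| <= _) => /=; case: (all _ _) => /=; lra.
Qed.

End BlockLaw.

Arguments block_sum : simpl never.

(** * Word counts in blocks *)

Section Typical.
Variables (R : realType) (mu : probability borel_shift_space R).
Hypothesis inv : shift_invariant mu.
Local Notation p := (cyl_mass mu).
Local Notation cnt v n x := (birkhoff_sum (\1_(cylinder v) : shift_space -> R) n x).

Definition block_cnt (k : nat) (v w : seq nat) : R := cnt v k (pad w).

(** Only occurrences starting in the last [size v] positions look beyond the common prefix. *)
Lemma cnt_le v (k : nat) x y : word x k = word y k ->
  `|cnt v k x - cnt v k y| <= (size v)%:R.
Proof.
move=> xy; have [kv|vk] := leqP k (size v).
  have /andP[? ?] := cnt_bounds R v k x; have /andP[? ?] := cnt_bounds R v k y.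
  have : k%:R <= (size v)%:R :> R by rewrite ler_nat.
  by rewrite ler_norml => ?; apply/andP; split; lra.
have /eq_word {}xy := xy.
have E : (k - size v + size v = k)%N by rewrite subnK// ltnW.
have same : cnt v (k - size v) x = cnt v (k - size v) y.
  rewrite /birkhoff_sum big_nat [RHS]big_nat; apply: eq_bigr => i /= ik.
  have wxy : word (iter i shift x) (size v) = word (iter i shift y) (size v).
    by apply/eq_word => t tv; rewrite !iter_shiftE xy//; lia.
  rewrite !indicE; congr ((_ : bool)%:R).
  by apply/idP/idP; rewrite !inE /cylinder/= wxy.
rewrite -E !birkhoff_sum_add same.
set a := cnt v (size v) _; set b := cnt v (size v) _.
have /andP[? ?] : 0 <= a <= (size v)%:R by exact: cnt_bounds.
have /andP[? ?] : 0 <= b <= (size v)%:R by exact: cnt_bounds.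
by rewrite ler_norml; apply/andP; split; lra.
Qed.

Lemma cnt_block_sum k v m w x : size w = (m * k)%N -> cylinder w x ->
  `|cnt v (m * k)%N x - block_sum k (block_cnt k v) m w| <= m%:R * (size v)%:R.
Proof.
elim: m w x => [|m IH] w x sw wx.
  by rewrite mul0n /birkhoff_sum big_geq// /block_sum subrr normr0 mul0r.
have wE : word x k ++ word (iter k shift x) (m * k)%N = w.
  by rewrite -word_add -mulSn -sw; exact: wx.
rewrite -wE block_sumS take_size_cat ?size_word// drop_size_cat ?size_word//.
rewrite mulSn birkhoff_sum_add.
set a := cnt v k x; set b := cnt v _ (iter k shift x).
set c := block_cnt k v _; set d := block_sum _ _ _ _.
rewrite (_ : a + b - (c + d) = (a - c) + (b - d)); last by ring.
apply: le_trans (ler_normD _ _) _; rewrite -natr1 mulrDl mul1r addrC lerD//.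
  by apply: IH; rewrite ?size_word// /cylinder/= size_word.
by rewrite /a /c /block_cnt cnt_le// word_pad_word.
Qed.

(** By invariance, each position where [v] fits in the block contributes [p v] up to the mass missed
    by [words N k]; the last [size v] positions are bounded trivially. *)
Lemma block_cnt_mean (N k : nat) v :
  `|\sum_(w <- words N k) p w * block_cnt k v w - k%:R * p v|
  <= k%:R * (1 - \sum_(w <- words N k) p w) + (size v)%:R.
Proof.
set d := 1 - _.
have near_term i : (i + size v <= k)%N ->
    `|\sum_(w <- words N k) p w * \1_(cylinder v) (iter i shift (pad w)) - p v| <= d.
  move=> ik; pose P (w : seq nat) := word (iter i shift (pad w)) (size v) == v.
  rewrite (eq_bigr (fun w => if P w then p w else 0)); last first.
    move=> w _; rewrite indicE /P; case: eqP => [H|H].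
      by rewrite mem_set ?mulr1.
    by rewrite memNset ?mulr0.
  rewrite -big_mkcond.
  have Pword x : P (word x k) = (word (iter i shift x) (size v) == v).
    rewrite /P; congr (_ == _); apply/eq_word => j jv; rewrite !iter_shiftE.
    by rewrite /pad nth_word//; lia.
  have muv : mu [set x | word (iter i shift x) (size v) = v] = (p v)%:E.
    by rewrite (mu_shift_word_set i (size v) (fun w => w = v) inv) -cyl_massE.
  have mP : measurable ([set x | word x k \in words N k /\ P (word x k)] : set borel_shift_space).
    exact: (@measurable_word_set k (fun w => w \in words N k /\ P w)).
  have mv : measurable ([set x | word (iter i shift x) (size v) = v] : set borel_shift_space).
    rewrite (_ : [set _ | _] = [set x | P (word x k)]).
      exact: (@measurable_word_set k P).
    by apply/seteqP; split => x /=; rewrite Pword => /eqP.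
  have up : \sum_(w <- words N k | P w) p w <= p v.
    rewrite -lee_fin -sum_words_cond -muv; apply: le_measure; rewrite ?inE//.
    by move=> x /= [_]; rewrite Pword => /eqP.
  have lo : p v <= \sum_(w <- words N k | P w) p w + d.
    pose A : set borel_shift_space := [set x | word x k \in words N k].
    have mA : measurable A by exact: (@measurable_word_set k (fun w => w \in words N k)).
    rewrite -lee_fin -muv EFinD -sum_words_cond.
    have -> : d%:E = mu (~` A).
      rewrite probability_setC// /A (@mass_mem _ _ k) ?words_uniq//.
      exact: size_mem_words.
    apply: le_trans (measureU2 _ _ _) => //; last exact: measurableC.
    apply: le_measure; rewrite ?inE//; first by apply: measurableU => //; exact: measurableC.
    move=> x /= xv; have [xA|] := pselect (A x); [left|by right].
    by split => //; rewrite Pword; apply/eqP.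
  by rewrite ler_norml; apply/andP; split; lra.
have d0 : 0 <= d by rewrite subr_ge0 sum_words_le1.
have exch m : \sum_(w <- words N k) p w * cnt v m (pad w) =
    \sum_(0 <= i < m) \sum_(w <- words N k) p w * \1_(cylinder v) (iter i shift (pad w)).
  by rewrite exchange_big/=; apply: eq_bigr => w _; rewrite mulr_sumr.
have first_part m : (m + size v <= k)%N ->
    `|\sum_(w <- words N k) p w * cnt v m (pad w) - m%:R * p v| <= m%:R * d.
  elim: m => [|m IH] mk.
    by rewrite exch big_geq// !mul0r subrr normr0.
  rewrite exch big_nat_recr//= -exch -natr1 !mulrDl !mul1r.
  set a := \sum_(w <- _) _; set b := \sum_(w <- _) _.
  rewrite (_ : a + b - _ = (a - m%:R * p v) + (b - p v)); last by ring.
  apply: le_trans (ler_normD _ _) _; rewrite lerD ?IH ?near_term//; lia.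
have trivial_part m (f : seq nat -> shift_space) :
    `|\sum_(w <- words N k) p w * cnt v m (f w) - m%:R * p v| <= m%:R.
  have h0 : 0 <= \sum_(w <- words N k) p w * cnt v m (f w).
    apply: sumr_ge0 => w _; rewrite mulr_ge0 ?cyl_mass_ge0//.
    by have /andP[] := cnt_bounds R v m (f w).
  have h1 : \sum_(w <- words N k) p w * cnt v m (f w) <= m%:R.
    apply: (@le_trans _ _ (\sum_(w <- words N k) p w * m%:R)).
      apply: ler_sum => w _; rewrite ler_wpM2l ?cyl_mass_ge0//.
      by have /andP[] := cnt_bounds R v m (f w).
    by rewrite -mulr_suml ler_piMl// sum_words_le1.
  have p0 := cyl_mass_ge0 mu v; have p1 := cyl_mass_le1 mu v.
  have h2 : 0 <= m%:R * p v by rewrite mulr_ge0.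
  have h3 : m%:R * p v <= m%:R by rewrite ler_piMr.
  by rewrite ler_norml; apply/andP; split; lra.
have [kv|vk] := leqP k (size v).
  apply: le_trans (trivial_part k pad) _; apply: (@le_trans _ _ (size v)%:R).
    by rewrite ler_nat.
  by rewrite lerDr mulr_ge0.
have E : (k - size v + size v = k)%N by rewrite subnK// ltnW.
rewrite (eq_bigr (fun w => p w * cnt v (k - size v) (pad w) +
    p w * cnt v (size v) (iter (k - size v) shift (pad w)))); last first.
  by move=> w _; rewrite -mulrDr -birkhoff_sum_add E.
rewrite big_split/=; have Ek : k%:R = (k - size v)%:R + (size v)%:R :> R by rewrite -natrD E.
set a := \sum_(w <- _) _; set b := \sum_(w <- _) _.
rewrite (_ : a + b - _ = (a - (k - size v)%:R * p v) + (b - (size v)%:R * p v));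
  last by rewrite Ek; ring.
apply: le_trans (ler_normD _ _) _; apply: lerD; last exact: trivial_part.
apply: le_trans (first_part _ _) _; first by rewrite E.
by rewrite ler_wpM2r// ler_nat leq_subr.
Qed.

End Typical.

(** * Construction of the block sets *)

Section StageExistence.
Variables (R : realType) (mu nu : probability borel_shift_space R) (K s : R).
Hypothesis inv : shift_invariant mu.
Hypothesis qb : quasi_bernoulli nu K.
Hypothesis s0 : 0 < s.
Local Notation p := (cyl_mass mu).
Local Notation q := (cyl_mass nu).
Local Notation cnt v n x := (birkhoff_sum (\1_(cylinder v) : shift_space -> R) n x).

Let K1 : 1 <= K. Proof. by case: qb. Qed.
Let K0 : 0 < K. Proof. exact: lt_le_trans K1. Qed.
Let q0 w : 0 < q w. Proof. by case: qb. Qed.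
Let qL u v : q u * q v <= K * q (u ++ v). Proof. by case: qb. Qed.

Definition total N k := \sum_(w <- words N k) p w.
(** The [k]-block law of [mu] conditioned on the first [N] letters. *)
Definition block_law_of N k (w : seq nat) := p w / total N k.

Lemma block_law_of_sum N k : 0 < total N k ->
  \sum_(w <- words N k) block_law_of N k w = 1.
Proof. by move=> t0; rewrite -mulr_suml divff// gt_eqF. Qed.

Lemma block_law_of_ge0 N k w : 0 <= block_law_of N k w.
Proof. by rewrite divr_ge0 ?cyl_mass_ge0// sumr_ge0// => *; exact: cyl_mass_ge0. Qed.

(** Conditioning moves the mean by at most [k%:R * (1 - total N k)], as much again as the truncation
    itself. *)
Lemma block_law_cnt_mean N k v : 0 < total N k ->
  `|\sum_(w <- words N k) block_law_of N k w * block_cnt R k v w - k%:R * p v|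
  <= 2 * k%:R * (1 - total N k) + (size v)%:R.
Proof.
move=> t0; have := block_cnt_mean inv N k v; rewrite -/(total N k).
set a := \sum_(w <- _) _ => ha.
have -> : \sum_(w <- words N k) block_law_of N k w * block_cnt R k v w = a / total N k.
  by rewrite /a mulr_suml; apply: eq_bigr => w _; rewrite mulrAC.
have t1 : total N k <= 1 by exact: sum_words_le1.
have a0 : 0 <= a.
  apply: sumr_ge0 => w _; rewrite mulr_ge0 ?cyl_mass_ge0//.
  by have /andP[] := cnt_bounds R v k (pad w).
have ak : a / total N k <= k%:R.
  rewrite ler_pdivrMr// mulr_sumr; apply: ler_sum => w _.
  rewrite mulrC ler_wpM2r ?cyl_mass_ge0//.
  by have /andP[] := cnt_bounds R v k (pad w).
have aE : a / total N k - a = a / total N k * (1 - total N k).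
  by field; rewrite gt_eqF.
have h0 : 0 <= a / total N k * (1 - total N k).
  by rewrite mulr_ge0 ?divr_ge0 ?(ltW t0)// subr_ge0.
have h1 : a / total N k * (1 - total N k) <= k%:R * (1 - total N k).
  by rewrite ler_wpM2r// subr_ge0.
move: ha; rewrite !ler_norml => /andP[h2 h3].
by apply/andP; split; lra.
Qed.

(** Three errors per block add up: [size v] at its boundary, 1 from the law of large numbers, and
    the bias of the conditioned mean. *)
Lemma blocks_typical (e : R) V N k m w : 0 < total N k -> size w = (m * k)%N ->
  (forall v, v \in V -> 2 * (size v)%:R + 1 + 2 * k%:R * (1 - total N k) <= e * k%:R) ->
  (forall v, v \in V -> `|block_sum k (block_cnt R k v) m w - m%:R *
    \sum_(u <- words N k) block_law_of N k u * block_cnt R k v u| <= 1 * m%:R) ->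
  typical mu e V (m * k)%N w.
Proof.
move=> t0 sw He Hw v x vV wx.
have h1 := cnt_block_sum R v sw wx; have h2 := Hw v vV.
have h3 := block_law_cnt_mean v t0; have h4 := He v vV.
move: h1 h2 h3; set a := cnt v _ _; set b := block_sum _ _ _ _.
set c := \sum_(u <- _) _ => h1 h2 h3.
have mR : 0 <= m%:R :> R by [].
have {}h3 : `|m%:R * c - m%:R * (k%:R * p v)| <=
    m%:R * (2 * k%:R * (1 - total N k) + (size v)%:R).
  by rewrite -mulrBr normrM (ger0_norm mR) ler_wpM2l.
have {}h4 := ler_wpM2l mR h4; rewrite natrM.
by move: h1 h2 h3; rewrite !ler_norml => /andP[? ?] /andP[? ?] /andP[? ?]; apply/andP; split; lra.
Qed.

(** A large [k] makes the boundary terms at most half of [e * k%:R]; then a large [N] makes the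
    missing mass less than [e / 4]. *)
Lemma block_size_large (e : R) (V : seq (seq nat)) : 0 < e -> exists k0, forall k, (k0 <= k)%N ->
  exists N0, forall N, (N0 <= N)%N -> 2^-1 < total N k /\
    forall v, v \in V -> 2 * (size v)%:R + 1 + 2 * k%:R * (1 - total N k) <= e * k%:R.
Proof.
move=> e0; pose M := \max_(v <- V) size v.
have e2 : 0 < e / 2 by lra.
have [k0 Hk0] := natural_large (2 * M%:R + 1) e2; exists k0 => k /Hk0 {}Hk0.
have d0 : 0 < Num.min (e / 4) 2^-1 by rewrite lt_min; apply/andP; split; lra.
have [N0 HN0] := sum_words_cvg1 mu k d0; exists N0 => N /HN0.
rewrite -/(total N k) ltrBlDr addrC -ltrBlDr lt_min => /andP[d1 d2].
split => [|v vV]; first by lra.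
have vM : (size v)%:R <= M%:R :> R by rewrite ler_nat; exact: (@leq_bigmax_seq _ _ xpredT size).
have kR : 0 <= k%:R :> R by [].
have := ler_wpM2l kR (ltW d1).
by lra.
Qed.

(** A tolerance of 1 per block is only [1 / k] per letter. *)
Definition near_mean N k m (fs : seq (seq nat -> R)) w := all (fun f =>
  `|block_sum k f m w - m%:R * \sum_(u <- words N k) block_law_of N k u * f u|
  <= 1 * m%:R) fs.

Lemma near_mean_mass N k fs : 0 < total N k -> exists m0, forall m, (m0 <= m)%N ->
  2^-1 <= \sum_(w <- words N (m * k)%N | near_mean N k m fs w)
            block_prod k (block_law_of N k) m w.
Proof.
move=> t0; have [m0 Hm0] := block_law (block_law_of_ge0 N k) (block_law_of_sum t0)
  fs ltr01 (dl := 2^-1) ltac:(lra).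
exists m0 => m /Hm0 Hbad.
have : \sum_(w <- words N (m * k)%N) block_prod k (block_law_of N k) m w = 1.
  by rewrite sum_block_prod block_law_of_sum// expr1n.
rewrite (bigID (near_mean N k m fs))/= => total1.
have {}Hbad : \sum_(w <- words N (m * k)%N | ~~ near_mean N k m fs w)
  block_prod k (block_law_of N k) m w <= 2^-1 by exact: Hbad.
by lra.
Qed.

Lemma typical_word_exists (e : R) V n1 : 0 < e ->
  exists n w, [/\ (n1 <= n)%N, size w = n & typical mu e V n w].
Proof.
move=> e0; have [k0 Hk0] := block_size_large V e0.
pose k := k0.+1; have [N0 /(_ N0 (leqnn _))[t2 Hv]] := Hk0 k (leqnSn _).
have t0 : 0 < total N0 k by lra.
have [m0 Hm0] := near_mean_mass [seq block_cnt R k v | v <- V] t0.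
pose m := maxn m0 n1; have {Hm0} := Hm0 m (leq_maxl _ _) => Hgood.
have [w wN good] : exists2 w, w \in words N0 (m * k)%N
    & near_mean N0 k m [seq block_cnt R k v | v <- V] w.
  apply: contrapT => none; move: Hgood; apply/negP; rewrite -ltNge.
  rewrite big_seq_cond big_pred0 => [|w]; first by lra.
  by apply/negP => /andP[wN good]; apply: none; exists w.
have sw := size_mem_words wN; exists (m * k)%N, w; split => //.
  by apply: leq_trans (leq_maxr m0 n1) _; rewrite leq_pmulr.
apply: (blocks_typical t0 sw Hv) => v vV.
by move: good => /allP; apply; exact: map_f.
Qed.

(* Since the sum of [q [:: a] `^ s] diverges, the normalization [Z] of the weights of the free
   letter can absorb the mass of the long typical word before it. *)
Lemma stage_of_divergence : (s%:E < conv_exponent nu)%E ->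
  forall e V, 0 < e -> exists n W P, stage mu nu K s e V n W P.
Proof.
move=> sa e V e0; have e2 : 0 < e / 2 by lra.
have [n1 Hn1] := natural_large 1 e2.
have [n [w [n1n sw tw]]] := typical_word_exists V n1 e2.
(* Bounded partial sums would make [s] a competitor in the infimum defining [conv_exponent nu]. *)
have un : forall M : R, exists N, M < \sum_(u <- words N 1) q u `^ s.
  move=> M; apply: contrapT => /forallNP H; move: sa; apply/negP; rewrite -leNgt.
  apply: ereal_inf_lbound; exists s => //; split => //.
  apply: (@le_lt_trans _ _ M%:E); last exact: ltry.
  apply: lime_le; first by apply: is_cvg_nneseries => i _ _; rewrite lee_fin powR_ge0.
  apply: nearW => N; rewrite sumEFin lee_fin big_mkord -(sum_words1 N (fun u => q u `^ s)).
  by rewrite leNgt; apply/negP.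
(* One [K] is for joining the typical word to the letter, the other for the division by [K] in
   [stage]. Then [2 / b < Z] yields the factor 1/2. *)
pose b := (q w / K / K) `^ s.
have b0 : 0 < b by rewrite powR_gt0// !divr_gt0.
have [N HN] := un (2 / b); set Z := \sum_(u <- _) _ in HN.
have Z0 : 0 < Z by apply: lt_trans HN; rewrite divr_gt0.
exists n.+1, [seq w ++ u | u <- words N 1], (fun x => q (drop n x) `^ s / Z).
split.
- by split => //; rewrite map_inj_uniq ?words_uniq// => u v /eqP; rewrite eqseq_cat// eqxx => /eqP.
- move=> _ /mapP[u uN ->]; have su := size_mem_words uN.
  split => [|v x vV]; first by rewrite size_cat sw su addn1.
  move=> /cylinder_cat[wx _]; rewrite -addn1.
  apply: le_trans (cnt_near_add (tw v x vV wx) (cnt_trivial mu v 1 _)) _.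
  have := Hn1 n n1n; rewrite natrD mulrDr mulr1 => ?.
  by lra.
- by move=> x; rewrite divr_ge0 ?powR_ge0// ltW.
- rewrite big_map -mulr_suml; under eq_bigr do rewrite (drop_size_cat _ sw).
  by rewrite divff// gt_eqF.
- move=> _ /mapP[u uN ->]; rewrite (drop_size_cat _ sw) ler_pdivrMr//.
  have h : b * q u `^ s <= (q (w ++ u) / K) `^ s.
    rewrite /b -powRM ?divr_ge0 ?(ltW K0) ?(ltW (q0 _))//.
    apply: ge0_ler_powR; first exact: ltW.
    + by rewrite nnegrE ?mulr_ge0 ?divr_ge0 ?invr_ge0 ?(ltW K0) ?(ltW (q0 _)).
    + by rewrite nnegrE ?divr_ge0 ?(ltW K0) ?(ltW (q0 _)).
    rewrite mulrAC ler_pM2r ?invr_gt0// mulrAC ler_pdivrMr// [leRHS]mulrC.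
    exact: qL.
  apply: (@le_trans _ _ (2^-1 * (b * q u `^ s) * Z)); last first.
    by rewrite ler_pM2r// ler_pM2l.
  rewrite ltr_pdivrMr// in HN.
  have qs : 0 <= q u `^ s by exact: powR_ge0.
  have := ler_wpM2r qs (ltW HN).
  by lra.
Qed.

Lemma block_prod_le (pr g : seq nat -> R) k m w : size w = (m * k)%N ->
  (forall u, 0 <= pr u) -> (forall u, pr u <= expR (g u) * q u `^ s) ->
  block_prod k pr m w <= expR (block_sum k g m w) * (K ^+ m * q w) `^ s.
Proof.
move=> sw pr0 prg; elim: m w sw => [|m IH] w sw.
  move: sw; rewrite mul0n => /size0nil ->.
  by rewrite /= /block_sum expR0 cyl_mass_nil expr0 !mul1r powR1.
have su : size (take k w) = k by rewrite size_takel// sw mulSn leq_addr.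
have sv : size (drop k w) = (m * k)%N by rewrite size_drop sw mulSn addKn.
rewrite block_sumS expRD /=.
apply: le_trans (ler_pM (pr0 _) (block_prod_ge0 _ _ _ pr0) (prg _) (IH _ sv)) _.
rewrite mulrACA ler_wpM2l ?mulr_ge0 ?expR_ge0//.
rewrite -powRM ?mulr_ge0 ?exprn_ge0 ?(ltW K0) ?(ltW (q0 _))//.
apply: ge0_ler_powR; first exact: ltW.
- by rewrite nnegrE !mulr_ge0 ?exprn_ge0 ?(ltW K0) ?(ltW (q0 _)).
- by rewrite nnegrE !mulr_ge0 ?exprn_ge0 ?(ltW K0) ?(ltW (q0 _)).
have := qL (take k w) (drop k w); rewrite cat_take_drop.
rewrite exprSr mulrCA -(mulrA (K ^+ m)); apply: ler_wpM2l.
by rewrite exprn_ge0// ltW.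
Qed.

Lemma lte_real_between_l (x : R) (y : \bar R) : (x%:E < y)%E ->
  exists x', x < x' /\ (x'%:E < y)%E.
Proof.
case: y => [r||] //; last by move=> _; exists (x + 1); rewrite ltry; split => //; lra.
by rewrite lte_fin => rs; exists ((x + r) / 2); rewrite lte_fin; split; lra.
Qed.

(* On a block word, the product of the weights [pr] is the exponential of the block sum of
   [g] times a power of the [nu]-mass, and the mean [G] of [g] is very negative. *)
Lemma stage_of_entropy : (s%:E < relative_exponent nu mu)%E ->
  forall e V, 0 < e -> exists n W P, stage mu nu K s e V n W P.
Proof.
move=> sb e V e0; have [s' [ss' s'b]] := lte_real_between_l sb.
have [theta [th qth]] := qb_decay qb; have /andP[th0 th1] := th.
have lnth : ln theta < 0 by rewrite ln_lt0// th.
have c0 : 0 < (s' - s) * - ln theta by rewrite mulr_gt0 ?subr_gt0 ?oppr_gt0.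
(* 1 is the tolerance of [near_mean]; one [s * ln K] pays for joining blocks, the other for the [K]
   in [stage]; [ln 4] pays for its factor 1/2 and for [Z >= 1/2], and [ln 2] for
   [total N k > 1/2]. *)
pose cost := 1 + 2 * (s * ln K) + ln 4 + ln 2.
have [k1 Hk1] := natural_large cost c0.
have [k2 Hk2] := block_size_large V e0.
have [k] := lt_limn_esupP s'b (maxn k1 k2).+1.
move=> /[dup] /(leq_ltn_trans (leq0n _)) k0 /ltnW; rewrite geq_max
  => /andP[/Hk1 {}Hk1 /Hk2[N0 HN0]].
move=> /lt_limn_esupP /(_ N0)[N /HN0[t2 Hv]].
rewrite lte_fin entropy_ratioE.
have leD := sum_ln_le mu qb k N th qth.
have t0 : 0 < total N k by lra.
have kln : k%:R * ln theta < 0 by rewrite nmulr_llt0 ?ltr0n.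
set E := \sum_(w <- _) p w * ln (p w); set D := \sum_(w <- _) p w * ln (q w) => HN1.
have {}leD : D <= k%:R * ln theta * total N k by exact: leD.
have D0 : D < 0 by apply: le_lt_trans leD _; rewrite pmulr_llt0.
rewrite ltr_ndivlMr// in HN1.
pose pr := block_law_of N k.
pose g w := ln (pr w) - s * ln (q w).
have meang : \sum_(w <- words N k) pr w * g w = (E - s * D) / total N k - ln (total N k).
  have E1 w : pr w * g w = (p w * ln (p w) - s * (p w * ln (q w))) / total N k
      - pr w * ln (total N k).
    rewrite /g /pr /block_law_of; have [->|pw0] := eqVneq (p w) 0.
      by rewrite !(mul0r, mulr0, subr0).
    rewrite ln_div ?posrE// ?lt0r ?pw0 ?cyl_mass_ge0//.
    by field; rewrite gt_eqF.
  under eq_bigr do rewrite E1.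
  have pr_sum : \sum_(w <- words N k) pr w = 1 by exact: block_law_of_sum t0.
  by rewrite sumrB -[X in _ - X]mulr_suml pr_sum mul1r -mulr_suml sumrB -mulr_sumr.
set G := \sum_(w <- _) _ in meang.
(* The ratio exceeds [s'] and [D] is negative, so [E < s' * D], and [E - s * D] is below a negative
   multiple of [k]. *)
have Gle : G + 1 + s * ln K <= - (ln 4 + s * ln K).
  have h1 : (E - s * D) / total N k <= (s' - s) * (k%:R * ln theta).
    rewrite ler_pdivrMr// -mulrA; apply: (@le_trans _ _ ((s' - s) * D)); first by lra.
    by rewrite ler_pM2l// subr_gt0.
  have h2 : - ln 2 <= ln (total N k).
    by rewrite -lnV ?posrE// ler_ln ?posrE// ltW.
  move: Hk1; rewrite (_ : k%:R * _ = - ((s' - s) * (k%:R * ln theta))); last by ring.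
  by rewrite meang /cost; lra.
(* A positive [m] is needed: the negative bound per block is used [m] times to pay a constant cost
   at least once. *)
have [m0 /(_ m0.+1 (leqnSn _))] := near_mean_mass (g :: [seq block_cnt R k v | v <- V]) t0.
set m := m0.+1; set good := near_mean N k m _; set Z := \sum_(w <- _ | _) _ => HZ.
have Z0 : 0 < Z by lra.
have goodP w : good w -> `|block_sum k g m w - m%:R * G| <= 1 * m%:R /\
    forall v, v \in V -> `|block_sum k (block_cnt R k v) m w - m%:R *
    \sum_(u <- words N k) pr u * block_cnt R k v u| <= 1 * m%:R.
  move=> /= /andP[gw /allP gV]; split => // v vV.
  by apply: gV; exact: map_f.
exists (m * k)%N, [seq w <- words N (m * k)%N | good w], (fun w => block_prod k pr m w / Z).
split.
- by rewrite muln_gt0 k0 filter_uniq// words_uniq.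
- move=> w; rewrite mem_filter => /andP[/goodP[_ gV] /size_mem_words sw]; split => //.
  exact: blocks_typical t0 sw Hv gV.
- move=> w; rewrite divr_ge0 ?(ltW Z0)// block_prod_ge0// => u.
  exact: block_law_of_ge0.
- by rewrite -mulr_suml big_filter divff// gt_eqF.
- move=> w; rewrite mem_filter => /andP[/goodP[gw _] /size_mem_words sw].
  have prg u : pr u <= expR (g u) * q u `^ s.
    rewrite /g; have [->|pr0] := eqVneq (pr u) 0.
      by rewrite mulr_ge0 ?expR_ge0 ?powR_ge0.
    have pru : 0 < pr u by rewrite lt0r pr0 block_law_of_ge0.
    rewrite expRD lnK ?posrE// expRN -ln_powR lnK ?posrE ?powR_gt0//.
    by rewrite divfK// gt_eqF// powR_gt0.
  have := block_prod_le sw (block_law_of_ge0 N k) prg.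
  move: gw; rewrite ler_norml mul1r => /andP[_ gw] BP.
  rewrite ler_pdivrMr//; apply: le_trans BP _.
  have qs : 0 < q w `^ s by rewrite powR_gt0.
  have Ks : 0 < K `^ s by rewrite powR_gt0.
  rewrite powRM ?exprn_ge0 ?(ltW K0) ?(ltW (q0 _))//.
  have -> : (q w / K) `^ s = q w `^ s / K `^ s.
    by rewrite powRM ?invr_ge0 ?(ltW K0) ?(ltW (q0 _))//
      -powR_inv1 ?(ltW K0)// powRAC powR_inv1 ?(ltW Ks).
  apply: (@le_trans _ _ (q w `^ s * (4^-1 / K `^ s))); last first.
    have : 0 < q w `^ s / K `^ s by rewrite divr_gt0.
    rewrite mulrCA; move: (q w `^ s / K `^ s) => t t00.
    have := ler_wpM2l (ltW t00) HZ; lra.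
  rewrite mulrA [leLHS]mulrC ler_pM2l//.
  have KE : (K ^+ m) `^ s = expR (m%:R * (s * ln K)).
    rewrite -[K ^+ m]powR_mulrn ?(ltW K0)// -powRrM /powR gt_eqF//.
    by congr expR; ring.
  rewrite KE -expRD -[4^-1]lnK ?posrE// -[(K `^ s)^-1]lnK ?posrE ?invr_gt0//.
  rewrite -expRD ler_expR !lnV ?posrE// ln_powR.
  have m1 : 1 <= m%:R :> R by rewrite ler1n.
  have ln4 : 0 <= ln 4 :> R by rewrite ln_ge0//; lra.
  have lnK0 : 0 <= s * ln K by rewrite mulr_ge0 ?(ltW s0)// ln_ge0.
  have : m%:R * (G + 1 + s * ln K) <= 1 * - (ln 4 + s * ln K).
    apply: (@le_trans _ _ (m%:R * - (ln 4 + s * ln K))); first by rewrite ler_pM2l// ltr0n.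
    by rewrite ler_wnM2r// oppr_le0 addr_ge0.
  by lra.
Qed.

End StageExistence.

(** * The dimension formula *)

Theorem theorem1 (R : realType) (mu nu : probability borel_shift_space R)
    (phi : shift_space -> R)
    (mu_inv : shift_invariant mu)
    (phi_var : summable_variations phi)
    (phi_gibbs : unique_gibbs phi nu) :
  billingsley_dim nu (generic_points mu)
    = maxe (conv_exponent nu) (relative_exponent nu mu).
Proof.
have [K qb] := gibbs_quasi_bernoulli phi_gibbs.1.
apply/eqP; rewrite eq_le; apply/andP; split; rewrite leNgt; apply/negP.
  set M := maxe _ _ => Mdim.
  (* Excludes [-oo], so that a real [s] fits strictly between [M] and the dimension. *)
  have M0 : (0 <= M)%E.
    rewrite /M le_max; apply/orP; left; apply: le_ereal_inf_tmp => _ [t [t0 _] <-].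
    by rewrite lee_fin ltW.
  have [s [Ms sdim]] : exists s : R, (M < s%:E)%E /\
      (s%:E < billingsley_dim nu (generic_points mu))%E.
    case E : M Mdim M0 => [r||] // rdim _; last by rewrite ltNge leey in rdim.
    by have [s [rs sdim]] := lte_real_between_l rdim; exists s; rewrite lte_fin.
  move: Ms; rewrite /M gt_max => /andP[as_ bs].
  have [s0 _] := letter_sum_bounded qb as_.
  move: sdim; apply/negP; rewrite -leNgt; apply: ereal_inf_lbound; exists s => //.
  by split => //; exact: (upper_bound qb as_ bs).
(* A dimension below the maximum gives an [s] with zero Hausdorff measure below one of the
   exponents, which the stages contradict. *)
move=> /ereal_inf_lt[_ [s [s0 H0] <-]]; rewrite lt_max => sM.
apply: (hausdorff_nonzero_of_stages qb s0 _ H0); case/orP: sM => [sa|sb].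
- exact: stage_of_divergence.
- exact: stage_of_entropy.
Qed.
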